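(* Let $d\ge 2$ and $k$ be constants. The query complexity of computing a discrete Brouwer fixed point of a bounded, direction-preserving function $f:[n]^d \to \{\mathbf{0}, \pm \vec{e}^1, \dots, \pm \vec{e}^d\}$ with at most $k$ rounds of queries is $\Theta\bigl(n^{\frac{d^{k+1} - d^k}{d^k - 1}}\bigr)$, for both deterministic and randomized algorithms.
   Context: $[n]=\{1,\dots,n\}$ and $\vec{e}^i$ is the $i$-th unit vector. $f$ is direction-preserving if $\|f(\vec{x})-f(\vec{y})\|_\infty \le 1$ whenever $\|\vec{x}-\vec{y}\|_\infty\le 1$, and bounded if $\vec{x}+f(\vec{x})\in[n]^d$ for all $\vec{x}\in[n]^d$; such $f$ has a point $\vec{x}^*$ with $f(\vec{x}^* )=\mathbf{0}$, and a discrete Brouwer fixed point is any such point. The algorithm has oracle access to $f$. In a $k$-round algorithm, each round's queries depend only on answers from earlier rounds (and random coins, if randomized); after round $k$ it outputs a solution. Deterministic query complexity: worst-case total number of queries to always succeed; randomized: worst-case expected number of queries of an algorithm that succeeds with probability at least $2/3$ on every input. Asymptotics are as $n\to\infty$. *)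

(* Defs.v *)
(* MathComp / MathComp-Analysis *)
From HB Require Import structures.
From mathcomp Require Import all_boot all_order all_algebra.
From mathcomp Require Import all_classical all_reals all_analysis.

Set Implicit Arguments.
Unset Strict Implicit.
Unset Printing Implicit Defensive.

Import Order.TTheory GRing.Theory Num.Theory.
Import numFieldNormedType.Exports.

Local Open Scope classical_set_scope.
Local Open Scope ring_scope.

(* Deterministic algorithms using at most k rounds of queries to an oracle
   Q -> Ans. A round submits m queries simultaneously (m depends on the earlier
   answers, may be 0, and repetitions are counted); how the algorithm proceeds
   is a function of the m answers received. *)
Inductive algorithm (Q Ans Out : Type) : nat -> Type :=
| Output k of Out : algorithm Q Ans Out k
| Round k m of m.-tuple Q & (m.-tuple Ans -> algorithm Q Ans Out k) :
    algorithm Q Ans Out k.+1.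

Fixpoint output Q Ans Out k (A : algorithm Q Ans Out k) (f : Q -> Ans) : Out :=
  match A with
  | Output _ o => o
  | Round _ _ qs next => output (next (map_tuple f qs)) f
  end.

Fixpoint num_queries Q Ans Out k (A : algorithm Q Ans Out k) (f : Q -> Ans) :
    nat :=
  match A with
  | Output _ _ => 0%N
  | Round _ m qs next => (m + num_queries (next (map_tuple f qs)) f)%N
  end.

Section query_complexity.
Context (R : realType) (Q Ans Out : Type).
(* [inputs] are the admissible oracles, [sol f] the solutions for input [f] *)
Variables (inputs : set (Q -> Ans)) (sol : (Q -> Ans) -> set Out).

Definition det_correct k (A : algorithm Q Ans Out k) :=
  forall f, inputs f -> sol f (output A f).

Definition det_cost k (A : algorithm Q Ans Out k) : \bar R :=
  ereal_sup [set (num_queries A f)%:R%:E | f in inputs].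

Definition det_query_complexity k : \bar R :=
  ereal_inf [set det_cost A | A in [set A | @det_correct k A]].

(* A randomized algorithm is a deterministic algorithm [A w] chosen by coins [w]
   from an arbitrary probability space; measurability of the success event and
   of the number of queries makes the quantities below meaningful. *)
Definition rand_correct d (T : measurableType d) (P : probability T R) k
    (A : T -> algorithm Q Ans Out k) :=
  forall f, inputs f ->
    [/\ measurable_fun [set: T] (fun w => (num_queries (A w) f)%:R : R),
        measurable [set w | sol f (output (A w) f)] &
        ((2 / 3)%:E <= P [set w | sol f (output (A w) f)])%E].

Definition rand_cost d (T : measurableType d) (P : probability T R) k
    (A : T -> algorithm Q Ans Out k) : \bar R :=
  ereal_sup [set ('E_P[fun w => (num_queries (A w) f)%:R])%E | f in inputs].

Definition rand_query_complexity k : \bar R :=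
  ereal_inf [set c | exists (d : measure_display) (T : measurableType d)
      (P : probability T R) (A : T -> algorithm Q Ans Out k),
    rand_correct P A /\ c = rand_cost P A].

End query_complexity.

Section discrete_brouwer.
Variables (d n : nat).

(* Index type of [n]^d; an ordinal i < n stands for i + 1 in [n] = {1, .., n}. *)
Definition point := 'rV['I_n]_d.

Definition vec_of (x : point) : 'rV[int]_d := \row_i (x 0 i).+1%:Z.

Definition in_grid (v : 'rV[int]_d) := forall i, 1 <= v 0 i <= n%:Z.

Definition is_direction (v : 'rV[int]_d) :=
  v = 0 \/ exists i : 'I_d, v = delta_mx 0 i \/ v = - delta_mx 0 i.

Definition bounded_function (f : point -> 'rV[int]_d) :=
  forall x, in_grid (vec_of x + f x).

(* [mx_norm] is the sup norm. *)
Definition direction_preserving (f : point -> 'rV[int]_d) :=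
  forall x y, mx_norm (vec_of x - vec_of y) <= 1 -> mx_norm (f x - f y) <= 1.

Definition brouwer_inputs : set (point -> 'rV[int]_d) :=
  [set f | [/\ forall x, is_direction (f x),
               bounded_function f & direction_preserving f]].

Definition fixed_points (f : point -> 'rV[int]_d) : set point :=
  [set x | f x = 0].

End discrete_brouwer.

(* The query complexities below are infima in [\bar R], equal to [+oo] if there
   is no correct algorithm, in which case [fine] yields 0. As a Theta of a
   positive function is eventually nonzero, such a degenerate value cannot
   satisfy a Theta bound. *)
Definition brouwer_det (R : realType) (d k n : nat) : R :=
  fine (det_query_complexity R (@brouwer_inputs d n) (@fixed_points d n) k).

Definition brouwer_rand (R : realType) (d k n : nat) : R :=
  fine (rand_query_complexity R (@brouwer_inputs d n) (@fixed_points d n) k).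

(* Main.v *)
(** Upper bound. Every admissible [f] has a zero, by a discrete Poincare-Miranda
    theorem modulo 2. If [f] is known on the walls that cut a box into cells and
    every admissible function with these values has a zero in the box, then some
    cell inherits this property: otherwise functions without zero in the
    individual cells could be glued along the walls. So each of the [k] rounds
    queries the walls of one box, and the sides [n = l_0 >= l_1 >= .. >= l_k = 1]
    are chosen such that all the costs [l_j ^ d / l_(j+1)] agree.

    Lower bound. The flow goes down except in a thin tube around the graph, over
    the last coordinate, of a random function made of [k] segments of sizes
    [l_0, .., l_(k-1)], and vanishes only at the end of the tube. A query that
    misses the segments that are still unknown reveals nothing about them, and
    it hits a segment of size [l_(j+1)], which starts at a random point of a box
    of side [l_j], with probability [O(l_(j+1) / l_j ^ d)]. So each round finds at
    most one new segment, and a last random bit in the position of the end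
    remains unknown. *)
Require Import Defs.
From mathcomp Require Import all_boot all_order all_algebra.
From mathcomp Require Import all_classical all_reals all_analysis.
From mathcomp Require Import measurable_realfun.
From mathcomp Require Import zify ring lra.

Import Order.TTheory GRing.Theory Num.Theory.
Import numFieldNormedType.Exports.

Local Open Scope classical_set_scope.
Local Open Scope ring_scope.

(** * A discrete Poincare-Miranda theorem *)

Section poincare_miranda.
Variables (d N : nat).
Local Notation pt := ('I_d -> nat).

Definition upd (w : pt) (m : 'I_d) (t : nat) : pt :=
  fun j => if j == m then t else w j.

Definition step (w : pt) (m : 'I_d) : pt := upd w m (w m).+1.

Lemma updE (w : pt) (m : 'I_d) (t : nat) : upd w m t m = t.
Proof. by rewrite /upd eqxx. Qed.

Lemma updNE (w : pt) (m j : 'I_d) (t : nat) : j != m -> upd w m t j = w j.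
Proof. by rewrite /upd => /negPf ->. Qed.

Lemma updC (w : pt) (m m' : 'I_d) (t t' : nat) : m != m' ->
  upd (upd w m t) m' t' = upd (upd w m' t') m t.
Proof.
move=> mm'; apply/funext => j; rewrite /upd.
by case: (j =P m') => // ->; rewrite eq_sym (negPf mm').
Qed.

Lemma stepC (w : pt) (m m' : 'I_d) : m != m' ->
  step (step w m) m' = step (step w m') m.
Proof.
move=> mm'; rewrite /step (updNE _ _ m') 1?eq_sym// (updNE _ _ m)//.
exact: updC.
Qed.

Lemma addxx2 (x : 'F_2) : x + x = 0.
Proof. exact/addrr_pchar2/pchar_Fp. Qed.

Lemma sum_sym_pairs (S : {set 'I_d}) (F : 'I_d -> 'I_d -> 'F_2) :
  (forall m m', m != m' -> F m m' = F m' m) ->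
  \sum_(m in S) \sum_(m' in S :\ m) F m m' = 0.
Proof.
move=> Fsym; rewrite pair_big_dep/=.
rewrite (bigID (fun p : 'I_d * 'I_d => p.1 < p.2)%N)/=.
set s1 := (X in X + _); set s2 := (X in _ + X).
suff -> : s2 = s1 by exact: addxx2.
rewrite /s1 /s2 (reindex (fun p : 'I_d * 'I_d => (p.2, p.1)))/=; last first.
  by exists (fun p : 'I_d * 'I_d => (p.2, p.1)) => -[].
apply: eq_big => [[m m']|[m m']]/=.
  rewrite !inE -leqNgt (eq_sym m' m).
  case: (m =P m') => [->|/eqP mm']/=; first by rewrite ltnn !andbF.
  by rewrite leq_eqVlt val_eqE (negPf mm')/= [in LHS](andbC (m' \in S)).
by rewrite !inE => /andP[/andP[_ /andP[mm' _]] _]; apply: Fsym; rewrite eq_sym.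
Qed.

Variable a : 'I_d -> pt -> 'F_2.

(* Value of the cochain da_(i_1) \cup .. \cup da_(i_r) on the cube with lowest
   vertex [v] and directions [S], for [L = [:: i_1; ..; i_r]]. *)
Fixpoint cup (L : seq 'I_d) (S : {set 'I_d}) (v : pt) : 'F_2 :=
  if L is i :: L' then
    \sum_(m in S) (a i (step v m) + a i v) * cup L' (S :\ m) (step v m)
  else 1.

(** The cup product of coboundaries is a cocycle. Once the first factor is expanded, the terms
    symmetric in the two directions cancel modulo 2, and the induction hypothesis matches the others
    in pairs. *)
Lemma cup_closed (L : seq 'I_d) (S : {set 'I_d}) (v : pt) :
  \sum_(m in S) cup L (S :\ m) (step v m) = \sum_(m in S) cup L (S :\ m) v.
Proof.
apply/eqP; rewrite -subr_eq0 (oppr_pchar2 (pchar_Fp _))//; apply/eqP.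
elim: L S v => [|i L IH] S v.
  by rewrite -big_split/= big1// => *; rewrite addxx2.
have {}IH (S' : {set 'I_d}) (v' : pt) : \sum_(m in S') cup L (S' :\ m) (step v' m) =
    \sum_(m in S') cup L (S' :\ m) v'.
  apply/eqP; rewrite -subr_eq0 (oppr_pchar2 (pchar_Fp _))//.
  by rewrite IH.
have sw (m m' : 'I_d) : S :\ m :\ m' = S :\ m' :\ m by rewrite finset.setDDl finset.setUC -finset.setDDl.
rewrite /=.
have -> : \sum_(m in S) \sum_(m' in S :\ m)
    (a i (step (step v m) m') + a i (step v m)) *
      cup L (S :\ m :\ m') (step (step v m) m') =
    \sum_(m in S) a i (step v m) * \sum_(m' in S :\ m) cup L (S :\ m :\ m') (step v m).
  transitivity (\sum_(m in S) \sum_(m' in S :\ m)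
      a i (step (step v m) m') * cup L (S :\ m :\ m') (step (step v m) m') +
      \sum_(m in S) \sum_(m' in S :\ m)
      a i (step v m) * cup L (S :\ m :\ m') (step (step v m) m')).
    rewrite -big_split; apply: eq_bigr => m _; rewrite -big_split.
    by apply: eq_bigr => m' _; rewrite mulrDl.
  rewrite sum_sym_pairs ?add0r; last by move=> m m' mm'; rewrite stepC// sw.
  by apply: eq_bigr => m _; rewrite -mulr_sumr IH.
transitivity (\sum_(m in S) a i (step v m) *
      (\sum_(m' in S :\ m) cup L (S :\ m :\ m') (step v m)) +
   (\sum_(m in S) \sum_(m' in S :\ m) a i (step v m') * cup L (S :\ m :\ m') (step v m') +
    \sum_(m in S) \sum_(m' in S :\ m) a i v * cup L (S :\ m :\ m') (step v m'))).
  congr (_ + _); rewrite -big_split; apply: eq_bigr => m _; rewrite -big_split.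
  by apply: eq_bigr => m' _; rewrite mulrDl.
have -> : \sum_(m in S) \sum_(m' in S :\ m) a i v * cup L (S :\ m :\ m') (step v m') = 0.
  transitivity (\sum_(m in S) \sum_(m' in S :\ m) a i v * cup L (S :\ m :\ m') v).
    by apply: eq_bigr => m _; rewrite -!mulr_sumr IH.
  by apply: sum_sym_pairs => m m' _; rewrite sw.
have -> : \sum_(m in S) \sum_(m' in S :\ m)
    a i (step v m') * cup L (S :\ m :\ m') (step v m') =
    \sum_(m in S) a i (step v m) *
      (\sum_(m' in S :\ m) cup L (S :\ m :\ m') (step v m)).
  rewrite (exchange_big_dep (mem S))/=; last by move=> m m' _; rewrite !inE => /andP[].
  apply: eq_bigr => m' m'S; rewrite mulr_sumr; apply: eq_big => [m|m _].
    by rewrite !inE m'S andbT eq_sym andbC.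
  by rewrite sw.
by rewrite addr0 addxx2.
Qed.

(** All vertices that enter the value share the coordinate [v m], so the factor of [a m] is a
    difference of equal values. *)
Lemma cup_eq0 (L : seq 'I_d) (S : {set 'I_d}) (v : pt) (m : 'I_d) (c : 'F_2) :
  (forall w : pt, w m = v m -> a m w = c) -> m \in L -> m \notin S ->
  cup L S v = 0.
Proof.
elim: L S v => // i L IH S v ac; rewrite inE => mL mS /=.
apply: big1 => l lS.
have ml : m != l by apply: contraNneq mS => ->.
have sv : step v l m = v m by rewrite /step updNE.
case/orP: mL => [/eqP <-|mL].
  by rewrite !ac// addxx2 mul0r.
rewrite IH ?mulr0// ?sv// !inE negb_and.
by rewrite mS orbT.
Qed.

Fixpoint box_sum (s : seq 'I_d) (F : pt -> 'F_2) (w : pt) : 'F_2 :=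
  if s is m :: s' then \sum_(t < N) box_sum s' F (upd w m t) else F w.

Lemma eq_box_sum (s : seq 'I_d) (F F' : pt -> 'F_2) (w : pt) :
  (forall v : pt, (forall j, j \notin s -> v j = w j) -> F v = F' v) ->
  box_sum s F w = box_sum s F' w.
Proof.
elim: s w => [|m s IH] w FF' /=; first by apply: FF'.
apply: eq_bigr => t _; apply: IH => v vw; apply: FF' => j.
by rewrite inE negb_or => /andP[jm js]; rewrite vw// updNE.
Qed.

Lemma box_sum0 (s : seq 'I_d) (w : pt) : box_sum s (fun=> 0) w = 0.
Proof. by elim: s w => //= m s IH w; apply: big1 => t _; exact: IH. Qed.

Lemma box_sumD (s : seq 'I_d) (F F' : pt -> 'F_2) (w : pt) :
  box_sum s (fun v => F v + F' v) w = box_sum s F w + box_sum s F' w.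
Proof.
elim: s w => //= m s IH w; rewrite -big_split/=.
by apply: eq_bigr => t _; exact: IH.
Qed.

Lemma box_sum_sum (s : seq 'I_d) (S : {set 'I_d}) (F : 'I_d -> pt -> 'F_2) (w : pt) :
  box_sum s (fun v => \sum_(m in S) F m v) w = \sum_(m in S) box_sum s (F m) w.
Proof.
elim: s w => //= m s IH w; rewrite exchange_big/=.
by apply: eq_bigr => t _; exact: IH.
Qed.

Lemma box_sum_upd (s : seq 'I_d) (F : pt -> 'F_2) (w : pt) (m : 'I_d) (t : nat) :
  m \notin s -> box_sum s (fun v => F (upd v m t)) w = box_sum s F (upd w m t).
Proof.
elim: s w => //= l s IH w; rewrite inE negb_or => /andP[ml ms].
by apply: eq_bigr => u _; rewrite IH// updC// eq_sym.
Qed.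

Lemma box_sum_rem (s : seq 'I_d) (F : pt -> 'F_2) (w : pt) (m : 'I_d) :
  m \in s -> uniq s ->
  box_sum s F w = \sum_(t < N) box_sum (rem m s) F (upd w m t).
Proof.
elim: s w => //= l s IH w; rewrite inE => /orP[/eqP ->|ms] /andP[ls us].
  by rewrite eqxx.
have lm : l != m by apply: contraNneq ls => ->.
rewrite (negPf lm)/= exchange_big/=; apply: eq_bigr => t _.
by rewrite IH//; apply: eq_bigr => u _; rewrite updC.
Qed.

Lemma box_sum_telescope (s : seq 'I_d) (F : pt -> 'F_2) (w : pt) (m : 'I_d) :
  m \in s -> uniq s ->
  (forall v : pt, v m = 0%N \/ v m = N -> F v = 0) ->
  box_sum s (fun v => F (step v m) + F v) w = 0.
Proof.
move=> ms us F0; rewrite (box_sum_rem _ _ _ _ ms us).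
have mr : m \notin rem m s by rewrite mem_rem_uniq// !inE eqxx.
pose g t := box_sum (rem m s) F (upd w m t).
transitivity (\sum_(0 <= t < N) (g t.+1 - g t)).
  rewrite big_mkord; apply: eq_bigr => t _.
  rewrite box_sumD (oppr_pchar2 (pchar_Fp _))//; congr (_ + _).
  rewrite /g.
  have -> : upd w m t.+1 = upd (upd w m t) m t.+1.
    by apply/funext => j; rewrite /upd; case: ifP.
  rewrite -(box_sum_upd _ F _ _ t.+1)//; apply: eq_box_sum => v vw.
  by rewrite /step vw// updE.
rewrite telescope_sumr//.
have g0 t : t = 0%N \/ t = N -> g t = 0.
  move=> t0; rewrite /g (@eq_box_sum _ _ (fun=> 0)) ?box_sum0// => v vw.
  by apply: F0; rewrite vw// updE.
by rewrite !g0 ?subrr; [|left|right].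
Qed.

(** The sum is the degree modulo 2 of the map with coordinates [a], which its boundary values
    determine. Normalising one coordinate reduces the dimension. *)
Lemma box_sum_cup (L : seq 'I_d) (w : pt) : (0 < N)%N ->
  (forall i (v : pt), v i = 0%N -> a i v = 0) ->
  (forall i (v : pt), v i = N -> a i v = 1) ->
  uniq L -> box_sum L (cup L [set x in L]) w = 1.
Proof.
move=> N0 a0 a1; elim: L w => // i L IH w /andP[iL uL].
set S := [set x in i :: L].
have iS : i \in S by rewrite !inE eqxx.
have SiE : S :\ i = [set x in L].
  apply/setP => j; rewrite !inE; case: (j =P i) => //= ->.
  by rewrite (negPf iL).
(* [a i] has the same values as [b] where [v i] is [0] or [N], and replacing
   [a i] by [b] does not change the sum. *)
pose b (v : pt) : 'F_2 := (0 < v i)%N%:R.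
pose c (v : pt) : 'F_2 := a i v + b v.
pose F (m : 'I_d) (v : pt) : 'F_2 := c v * cup L (S :\ m) v.
(* As [cup L] is closed, passing from [a i] to [b] changes the product by the coboundary of [c]
   times [cup L]. The factor of [b] is nonzero only on edges in direction [i] that start at
   [v i = 0]. *)
have cup_split v : cup (i :: L) S v =
    (v i == 0)%N%:R * cup L (S :\ i) (step v i) +
    \sum_(m in S) (F m (step v m) + F m v).
  have -> : \sum_(m in S) (F m (step v m) + F m v) =
      \sum_(m in S) (c (step v m) + c v) * cup L (S :\ m) (step v m).
    rewrite /F big_split/= -mulr_sumr -cup_closed mulr_sumr -big_split/=.
    by apply: eq_bigr => m _; rewrite [RHS]mulrDl.
  have -> : (v i == 0)%N%:R * cup L (S :\ i) (step v i) =
      \sum_(m in S) (b (step v m) + b v) * cup L (S :\ m) (step v m).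
    rewrite (bigD1 i)//= big1 ?addr0 => [|m /andP[_ mi]].
      congr (_ * _); rewrite /b /step updE ltnS leq0n lt0n.
      by case: (v i == 0)%N; rewrite ?addr0// addxx2.
    by rewrite /b /step updNE ?addxx2 ?mul0r// eq_sym.
  rewrite /= -big_split/=; apply: eq_bigr => m _; rewrite -mulrDl /c.
  congr (_ * _).
  have -> : b (step v m) + b v + (a i (step v m) + b (step v m) + (a i v + b v)) =
      a i (step v m) + a i v + ((b (step v m) + b (step v m)) + (b v + b v)) by ring.
  by rewrite !addxx2 !addr0.
rewrite (@eq_box_sum _ _ (fun v => (v i == 0)%N%:R * cup L (S :\ i) (step v i) +
    \sum_(m in S) (F m (step v m) + F m v)))//.
(* The coboundary telescopes in each direction [m]. On the two extreme faces [F m] vanishes: for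
   [m = i] because [c] does, otherwise because [a m] is constant there. *)
rewrite box_sumD box_sum_sum [X in _ + X]big1 ?addr0 => [|m]; last first.
  rewrite inE => mL; apply: box_sum_telescope => //=; first exact/andP.
  move=> v vm; rewrite /F; have [mi|mi] := eqVneq m i.
    rewrite /c /b -mi; case: vm => vm; first by rewrite a0// vm add0r mul0r.
    by rewrite a1// vm N0 addxx2 mul0r.
  case: vm => vm.
    rewrite (@cup_eq0 _ _ _ m 0) ?mulr0//.
    - by move=> u um; rewrite a0// um.
    - by move: mL; rewrite inE (negPf mi).
    - by rewrite !inE eqxx.
  rewrite (@cup_eq0 _ _ _ m 1) ?mulr0//.
  - by move=> u um; rewrite a1// um.
  - by move: mL; rewrite inE (negPf mi).
  - by rewrite !inE eqxx.
rewrite /= -(prednK N0) big_ord_recl big1 ?addr0 => [|t _].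
  rewrite (@eq_box_sum _ _ (fun v => cup L [set x in L] (upd v i 1)))//.
    by rewrite box_sum_upd// IH.
  by move=> v vw; rewrite SiE /step vw// updE eqxx mul1r.
rewrite -[RHS](box_sum0 L (upd w i (lift ord0 t))); apply: eq_box_sum => v vw.
by rewrite vw// updE mul0r.
Qed.

Lemma box_sum_neq0 (s : seq 'I_d) (F : pt -> 'F_2) (w : pt) :
  box_sum s F w != 0 ->
  exists2 v : pt, (forall j, j \in s -> (v j < N)%N) & F v != 0.
Proof.
suff H w' : box_sum s F w' != 0 -> exists v : pt,
    [/\ forall j, j \in s -> (v j < N)%N,
        forall j, j \notin s -> v j = w' j & F v != 0].
  by move=> /H[v [vs _ Fv]]; exists v.
elim: s w' => [|m s IH] w' /= F0; first by exists w'.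
have [t /IH[v [vs vw Fv]]] : exists t : 'I_N, box_sum s F (upd w' m t) != 0.
  apply/existsP; apply: contraNT F0; rewrite negb_exists => /forallP F0.
  by apply/eqP/big1 => t _; apply/eqP; have := F0 t; rewrite negbK.
exists v; split=> // j; rewrite inE.
  case: (boolP (j \in s)) => [/vs//|/vw ->]; rewrite orbF => /eqP ->.
  by rewrite updE.
by rewrite negb_or => /andP[jm /vw ->]; rewrite updNE.
Qed.

(** A nonzero sum has a nonzero term. Such a term is a monotone path in the cube, and each [a i]
    changes along one of its edges. *)
Lemma cup_neq0 (L : seq 'I_d) (S : {set 'I_d}) (v : pt) : cup L S v != 0 ->
  forall i, i \in L -> exists p q : pt,
    [/\ forall j, (v j <= p j <= (v j).+1)%N,
        forall j, (v j <= q j <= (v j).+1)%N & a i p != a i q].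
Proof.
(* [v'] is the current vertex of the path and [S] the set of directions still available. *)
suff H v' : cup L S v' != 0 -> (forall j, j \in S -> v' j = v j) ->
    (forall j, (v j <= v' j <= (v j).+1)%N) ->
    forall i, i \in L -> exists p q : pt,
    [/\ forall j, (v j <= p j <= (v j).+1)%N,
        forall j, (v j <= q j <= (v j).+1)%N & a i p != a i q].
  by move=> /H; apply=> // j; rewrite leqnn leqnSn.
elim: L S v' => // l L IH S v' /= c0 vS vv' i.
have [m mS] : exists2 m, m \in S &
    (a l (step v' m) + a l v') * cup L (S :\ m) (step v' m) != 0.
  apply/exists_inP; apply: contraNT c0; rewrite negb_exists => /forallP c0.
  apply/eqP/big1 => m mS; apply/eqP; have := c0 m; rewrite mS.
  by rewrite negbK.
rewrite mulf_eq0 negb_or => /andP[am cm].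
have sv j : (v j <= step v' m j <= (v j).+1)%N.
  rewrite /step /upd; case: eqP => [->|_]; last exact: vv'.
  by rewrite vS// leqnn leqnSn.
rewrite inE => /orP[/eqP ->|].
  exists (step v' m), v'; split => //.
  by apply: contraNneq am => ->; rewrite addxx2.
apply: (IH _ _ cm) => // j; rewrite !inE => /andP[jm jS].
by rewrite /step updNE// vS.
Qed.

End poincare_miranda.

(** The degree is 1, so some cube carries a nonzero product, and there every label changes. *)
Lemma discrete_poincare_miranda (d N : nat) (a : 'I_d -> ('I_d -> nat) -> bool) :
  (0 < N)%N ->
  (forall i v, v i = 0%N -> a i v = false) ->
  (forall i v, v i = N -> a i v = true) ->
  exists2 v : 'I_d -> nat, (forall j, (v j < N)%N) &
    forall i, exists p q : 'I_d -> nat,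
    [/\ forall j, (v j <= p j <= (v j).+1)%N,
        forall j, (v j <= q j <= (v j).+1)%N & a i p != a i q].
Proof.
move=> N0 a0 a1; pose a' i v : 'F_2 := (a i v)%:R.
have H : box_sum d N (enum 'I_d) (cup d a' (enum 'I_d) [set x in enum 'I_d])
    (fun=> 0%N) = 1.
  apply: box_sum_cup (enum_uniq _) => // i v vi; rewrite /a'; first by rewrite a0.
  by rewrite a1.
have [|v vN] := @box_sum_neq0 d N (enum 'I_d) (cup d a' (enum 'I_d)
    [set x in enum 'I_d]) (fun=> 0%N).
  by rewrite H oner_eq0.
move=> /cup_neq0 c0; exists v => [j|i]; first by apply: vN; rewrite mem_enum.
have [|p [q [vp vq apq]]] := c0 i; first by rewrite mem_enum.
by exists p, q; split => //; apply: contraNneq apq => apq; rewrite /a' apq.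
Qed.

(** * Existence of a discrete fixed point *)

Section grid.
Variables (d n : nat).
Local Notation point := (Defs.point d n).
Implicit Types (x y z : point) (f g : point -> 'rV[int]_d).

Lemma mx_norm_le1 (v : 'rV[int]_d) :
  mx_norm v <= 1 <-> forall i, -1 <= v 0 i <= 1.
Proof.
rewrite mx_normE -[1]nngE num_le; split => [/bigmax_leP[_ v1] i|v1].
  by have := v1 (0, i) erefl; rewrite -num_le/= ler_norml.
apply/bigmax_leP; split => // -[i j] _; rewrite -num_le/= ler_norml ord1.
exact: v1.
Qed.

Definition coord x (i : 'I_d) : nat := x 0 i.

Definition adjacent x y :=
  forall i, (coord x i <= (coord y i).+1)%N && (coord y i <= (coord x i).+1)%N.

Lemma adjacentP x y : mx_norm (vec_of x - vec_of y) <= 1 <-> adjacent x y.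
Proof.
rewrite mx_norm_le1; split => xy i; have := xy i; rewrite !mxE /coord; lia.
Qed.

Lemma direction_preservingP f : direction_preserving f <->
  forall x y, adjacent x y -> forall i, -1 <= f x 0 i - f y 0 i <= 1.
Proof.
split => [fdp x y /adjacentP/fdp/mx_norm_le1 xy i|fdp x y /adjacentP/fdp xy].
  by have := xy i; rewrite !mxE.
by apply/mx_norm_le1 => i; rewrite !mxE.
Qed.

(** If there is no zero, let label [i] record a nearby value [-e_i] or the upper end of the range.
    In a cube where all labels change, the value at its grid point [z] lies along some axis [c]. Yet
    label [c] is constant there: true for a negative value, false for a positive one, as points near
    a common vertex are adjacent and cannot have opposite values. *)
Lemma brouwer_fixed_point f : (0 < n)%N -> brouwer_inputs f ->
  exists x, f x = 0.
Proof.
move=> n0 [fdir fbnd /direction_preservingP fdp].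
apply: contrapT => /forallNP fN0.
(* [v] ranges over the grid refined by two, in which [z] becomes the cube
   [2 z, 2 z + 1]^d and [near z v] means distance at most 1 to this cube. *)
pose near z (v : 'I_d -> nat) :=
  forall j, (2 * coord z j <= (v j).+1)%N && (v j <= (2 * coord z j).+2)%N.
pose a i (v : 'I_d -> nat) :=
  `[< (exists2 z, near z v & f z = - delta_mx 0 i) \/ ((2 * n).-1 <= v i)%N >].
have N0 : (0 < (2 * n).-1)%N by lia.
have [i v vi|i v vi|v vN vjump] := @discrete_poincare_miranda d _ a N0.
- apply/asboolPn => -[[z /(_ i) zv fz]|]; last by lia.
  by have := fbnd z i; rewrite /coord in zv *; rewrite fz !mxE !eqxx; lia.
- by apply/asboolP; right; lia.
have zn j : (v j %/ 2 < n)%N by have := vN j; lia.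
pose z : point := \row_j Ordinal (zn j).
have nearz p : (forall j, (v j <= p j <= (v j).+1)%N) -> near z p.
  by move=> vp j; rewrite /coord mxE/=; have := vp j; lia.
have [//|[c fz]] := fdir z; first by move=> /fN0.
have [p [q [vp vq /negP]]] := vjump c; apply; apply/eqP.
case: fz => fz; last first.
  by transitivity true; [|symmetry]; apply/asboolP; left; exists z => //;
    exact: nearz.
suff H r : (forall j, (v j <= r j <= (v j).+1)%N) -> a c r = false by rewrite !H.
move=> vr; apply/asboolPn => -[[z' z'r fz']|rc]; last first.
  by have := fbnd z c; rewrite fz !mxE !eqxx/=; have := vr c; lia.
have zz' : adjacent z z'.
  by move=> j; have := z'r j; have := nearz _ vr j; lia.
by have := fdp _ _ zz' c; rewrite fz fz' !mxE !eqxx.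
Qed.

End grid.

(** * The algorithm *)

Section upper_bound.
Variables (d' n : nat).
Local Notation d := d'.+1.
Local Notation point := (Defs.point d n).
Local Notation oracle := (point -> 'rV[int]_d).
Implicit Types (x y : point) (f g : oracle) (S B : {set point}).

(* The inner boundary of [B] lies in [S], hence functions that agree on [S] can
   be exchanged inside [B]. *)
Definition certified f S B :=
  (forall x y, x \in B -> y \notin B -> adjacent d n x y -> x \in S) /\
  forall g, brouwer_inputs g -> (forall x, x \in S -> g x = f x) ->
  exists2 x, x \in B & g x = 0.

Lemma eq_certified f g S B : (forall x, x \in S -> f x = g x) ->
  certified f S B -> certified g S B.
Proof.
move=> fg [SB fB]; split => // h hin hg; apply: fB => // x xS.
by rewrite hg// fg.
Qed.

(** Cells are closed, so that neighbours share a wall and any two adjacent points lie in a common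
    cell. *)
Definition cell (s : nat) (c : 'I_d -> nat) : {set point} :=
  [set x | [forall i, (c i * s <= coord d n x i <= (c i).+1 * s)%N]].

Lemma cellP (s : nat) (c : 'I_d -> nat) (x : point) :
  reflect (forall i, (c i * s <= coord d n x i <= (c i).+1 * s)%N) (x \in cell s c).
Proof. by rewrite inE; exact: forallP. Qed.

Definition wall (s : nat) : {set point} :=
  [set x | [exists i, (s %| coord d n x i)%N]].

Lemma wallP (s : nat) (x : point) :
  reflect (exists i, (s %| coord d n x i)%N) (x \in wall s).
Proof. by rewrite inE; exact: existsP. Qed.

(* If the data left every cell [c] a function [g c] without zero in it, these
   functions, which agree on the walls, could be glued to a function without
   any zero in [B]. *)
Lemma certified_refine f S B (s : nat) : (0 < s)%N -> brouwer_inputs f ->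
  certified f S B ->
  exists c, certified f (S :|: (B :&: wall s)) (B :&: cell s c).
Proof.
move=> s0 fin [SB fB]; set S' := S :|: _.
have closed c x y : x \in B :&: cell s c -> y \notin B :&: cell s c ->
    adjacent d n x y -> x \in S'.
  rewrite !inE => /andP[xB xc]; have [yB|yB]/= := boolP (y \in B); last first.
    by move=> _ xy; rewrite (SB x y).
  rewrite xB/= negb_forall => /existsP[i yi] xy; apply/orP; right.
  apply/existsP; exists i; move/forallP : xc => /(_ i) xi.
  have xyi := xy i; move: yi; rewrite negb_and -!ltnNge => yi.
  have [->|->] : coord d n x i = (c i * s)%N \/ coord d n x i = ((c i).+1 * s)%N.
  - by lia.
  - exact: dvdn_mull.
  - exact: dvdn_mull.
apply: contrapT => /forallNP nc.
have {nc} /choice[g gP] c : exists g, [/\ brouwer_inputs g,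
    forall x, x \in S' -> g x = f x &
    forall x, x \in B -> x \in cell s c -> g x <> 0].
  apply: contrapT => /forallNP H; apply: (nc c); split; first exact: closed.
  move=> g gin gf; apply: contrapT => g0; apply: (H g); split => // x xB xc gx.
  by apply: g0; exists x; rewrite // inE xB.
pose cof x i := (coord d n x i %/ s)%N.
have cofP x : x \in cell s (cof x).
  by apply/cellP => i; rewrite leq_divM/= ltnW// -ltn_divLR// ltnS.
pose h x := if x \in B then g (cof x) x else f x.
have hS x : x \in S' -> h x = f x.
  by rewrite /h; case: ifP => // _; case: (gP (cof x)) => _ + _; apply.
(* Cells overlap only in walls, where every [g c] equals [f]. So [h] can be read off from any cell
   that contains the point. *)
have hg c x : x \in B -> x \in cell s c -> h x = g c x.
  move=> xB xc; have [cx|/existsNP[i /eqP ci]] := pselect (forall i, cof x i = c i).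
    by rewrite /h xB (_ : cof x = c)//; exact/funext.
  have xS : x \in S'.
    rewrite !inE xB/=; apply/orP; right; apply/existsP; exists i.
    move/cellP : xc => /(_ i); move: ci; rewrite /cof; set t := coord _ _ _ _.
    move=> ti /andP[ct tc]; suff -> : t = ((c i).+1 * s)%N by exact: dvdn_mull.
    apply/eqP; rewrite eqn_leq tc leqNgt; apply: contra ti => tlt.
    by rewrite eqn_leq -ltnS ltn_divLR// tlt leq_divRL.
  by rewrite hS//; case: (gP c) => _ /(_ _ xS).
have [fdir fbnd /direction_preservingP fdp] := fin.
have hin : brouwer_inputs h.
  split.
  - by move=> x; rewrite /h; case: ifP => // _; case: (gP (cof x)) => -[+ _ _] _ _; apply.
  - by move=> x; rewrite /h; case: ifP => // _; case: (gP (cof x)) => -[_ + _] _ _; apply.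
  apply/direction_preservingP => x y xy.
  (* If one point is outside [B], the other is outside too or on the inner boundary, so both values
     come from [f]. *)
  have [xB|xB] := boolP (x \in B); last first.
    have hy : h y = f y.
      have [yB|yB] := boolP (y \in B); last by rewrite /h (negPf yB).
      apply: hS; rewrite inE (SB y x)// => i.
      by have := xy i; rewrite andbC.
    by rewrite hy (_ : h x = f x) ?/h ?(negPf xB)//; exact: fdp.
  have [yB|yB] := boolP (y \in B); last first.
    rewrite hS ?inE ?(SB x y)// (_ : h y = f y) ?/h ?(negPf yB)//.
    exact: fdp.
  (* Rounding down the smaller coordinates gives a cell containing both points. *)
  pose c i := (minn (coord d n x i) (coord d n y i) %/ s)%N.
  have xyc i : (c i * s <= minn (coord d n x i) (coord d n y i))%N /\
      (minn (coord d n x i) (coord d n y i) < (c i).+1 * s)%N.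
    by rewrite leq_divM -ltn_divLR// ltnS.
  rewrite !(hg c)//; last 2 first.
  - by apply/cellP => i; have := xyc i; have := xy i; lia.
  - by apply/cellP => i; have := xyc i; have := xy i; lia.
  by case: (gP c) => -[_ _ /direction_preservingP gdp] _ _; exact: gdp.
have [|x xB hx] := fB h hin; first by move=> x xS; rewrite hS// inE xS.
case: (gP (cof x)) => _ _ /(_ x xB (cofP x)); apply.
by rewrite -hx; symmetry; exact: hg.
Qed.

(** A wall point is determined by a direction in which [s] divides its coordinate, the quotient
    there, and the other coordinates. On an interval of length [l] the quotient takes at most
    [l %/ s + 2] values. *)
Lemma card_cell_wall (l s : nat) (c : 'I_d -> nat) B : (0 < s)%N ->
  B \subset cell l c ->
  (#|B :&: wall s| <= d * ((l %/ s).+2 * l.+1 ^ d'))%N.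
Proof.
move=> s0 /fintype.subsetP Bc.
pose idx x : 'I_d := odflt ord0 [pick i | (s %| coord d n x i)%N].
pose phi x : 'I_d * ('I_(l %/ s).+2 * {ffun 'I_d' -> 'I_l.+1}) :=
  (idx x, (inord (coord d n x (idx x) %/ s - c (idx x) * l %/ s),
    [ffun j => inord (coord d n x (lift (idx x) j) - c (lift (idx x) j) * l)])).
have phi_inj : {in B :&: wall s &, injective phi}.
  move=> x y; rewrite !finset.in_setI => /andP[/Bc/cellP xc /wallP[ix xw]].
  move=> /andP[/Bc/cellP yc /wallP[iy yw]] [ii q]; rewrite -ii in q * => r.
  have xi : (s %| coord d n x (idx x))%N.
    by rewrite /idx; case: pickP => //= /(_ ix); rewrite xw.
  have yi : (s %| coord d n y (idx x))%N.
    by rewrite ii /idx; case: pickP => //= /(_ iy); rewrite yw.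
  apply/rowP => i; apply/val_inj; change (coord d n x i = coord d n y i).
  have [j|->] := unliftP (idx x) i.
    move=> ->; move/ffunP : r => /(_ j); rewrite !ffunE => /(congr1 val)/=.
    have := xc (lift (idx x) j); have := yc (lift (idx x) j).
    by move=> ? ?; rewrite !inordK; lia.
  have qlt t : (c (idx x) * l <= t <= (c (idx x)).+1 * l)%N ->
      (t %/ s - c (idx x) * l %/ s < (l %/ s).+2)%N /\
      (c (idx x) * l %/ s <= t %/ s)%N.
    move=> /andP[t1 t2]; split; last exact: leq_div2r.
    rewrite ltn_subLR; last exact: leq_div2r.
    rewrite ltn_divLR// (leq_ltn_trans t2)//.
    have := divn_eq l s; have := divn_eq (c (idx x) * l)%N s.
    have := ltn_pmod l s0; have := ltn_pmod (c (idx x) * l)%N s0.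
    move: (c (idx x) * l %/ s)%N (l %/ s)%N (l %% s)%N (c (idx x) * l %% s)%N.
    by move=> a b r1 r2 H1 H2 E1 E2; rewrite mulSn E1 {1}E2; lia.
  have [q1 q2] := qlt _ (xc (idx x)); have [q3 q4] := qlt _ (yc (idx x)).
  move: q => /(congr1 val)/=; rewrite !inordK// => q.
  rewrite -(divnK xi) -(divnK yi); congr (_ * _)%N; lia.
rewrite -(card_in_imset phi_inj) (leq_trans (max_card _))//.
by rewrite !card_prod card_ffun !card_ord.
Qed.

(** [f0] stands for the answers received on [S], on which alone being certified depends. After a
    round, any admissible function with the new answers takes its place; answers that no admissible
    function gives may be treated arbitrarily. *)
Lemma certified_algorithm (q l : nat) (ls : seq nat) (c : 'I_d -> nat) f0 S B :
  path (fun l s => (0 < s)%N && (d * ((l %/ s).+2 * l.+1 ^ d') <= q)%N) l ls ->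
  last 1%N ls = 1%N ->
  B \subset cell l c -> (ls = [::] -> B \subset S) ->
  brouwer_inputs f0 -> certified f0 S B ->
  exists A : algorithm point 'rV[int]_d point (size ls),
  forall f, brouwer_inputs f -> (forall x, x \in S -> f x = f0 x) ->
  fixed_points f (output A f) /\ (num_queries A f <= size ls * q)%N.
Proof.
elim: ls l c f0 S B => [|s ls IH] l c f0 S B /= lls lst Bc BS f0in f0B.
  have [x xB f0x] := f0B.2 f0 f0in (fun _ _ => erefl).
  exists (Output _ _ 0 x) => f fin ff0; split => //=.
  by rewrite /fixed_points/= ff0//; exact: (fintype.subsetP (BS erefl)).
have [x0 _ _] := f0B.2 f0 f0in (fun _ _ => erefl).
move/andP : lls => [/andP[s0 lsq] pls].
set T := B :&: wall s.
pose qs : #|T|.-tuple point := enum_tuple T.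
have /choice[next nextP] (t : #|T|.-tuple 'rV[int]_d) :
    exists A : algorithm point 'rV[int]_d point (size ls),
    forall f, brouwer_inputs f -> (forall x, x \in S -> f x = f0 x) ->
    map_tuple f qs = t ->
    fixed_points f (output A f) /\ (num_queries A f <= size ls * q)%N.
  have [[f1 [f1in f10 f1t]]|nof1] := pselect (exists f1, [/\ brouwer_inputs f1,
    forall x, x \in S -> f1 x = f0 x & map_tuple f1 qs = t]); last first.
    exists (Output _ _ _ x0) => f fin ff0 ft; exfalso; apply: nof1.
    by exists f.
  have f1B : certified f1 S B by apply: eq_certified f0B => x /f10.
  have [c' f1c'] := certified_refine _ _ _ _ s0 f1in f1B.
  have [|||A AP] := IH s c' f1 _ _ pls _ _ _ f1in f1c'.
  - by case: (ls) lst.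
  - exact: subsetIr.
  (* In the last round the side is 1 and every point lies on a wall, so the final cell is known
     entirely. *)
  - move=> ls0; move: lst; rewrite ls0/= => ->; apply/fintype.subsetP => x.
    rewrite !inE => /andP[-> _]/=; apply/orP; right.
    by apply/existsP; exists ord0; exact: dvd1n.
  exists A => f fin ff0 ft; apply: AP => // x; rewrite inE => /orP[xS|xT].
    by rewrite ff0// f10.
  have : map f (enum T) = map f1 (enum T).
    by have := congr1 val (etrans ft (esym f1t)).
  by move=> /eq_in_map; apply; rewrite mem_enum.
exists (Round qs next) => f fin ff0 /=.
have [? nq] := nextP _ f fin ff0 erefl; split => //.
rewrite mulSn leq_add// (leq_trans _ lsq)//.
exact: card_cell_wall Bc.
Qed.

End upper_bound.

(** The first box is the whole grid, certified without queries by the existence of a fixed point. *)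
Lemma brouwer_algorithm (d' n q : nat) (ls : seq nat) : (0 < n)%N ->
  path (fun l s => (0 < s)%N && (d'.+1 * ((l %/ s).+2 * l.+1 ^ d') <= q)%N) n ls ->
  ls != [::] -> last 1%N ls = 1%N ->
  exists2 A : algorithm (Defs.point d'.+1 n) 'rV[int]_d'.+1
      (Defs.point d'.+1 n) (size ls),
    det_correct (@brouwer_inputs d'.+1 n) (@fixed_points d'.+1 n) A &
    forall f, brouwer_inputs f -> (num_queries A f <= size ls * q)%N.
Proof.
move=> n0 pls ls0 lst.
have [[f0 f0in]|nof] := pselect (exists f, @brouwer_inputs d'.+1 n f); last first.
  exists (Output _ _ _ (const_mx (Ordinal n0))) => f fin; exfalso; apply: nof.
    by exists f.
  by exists f.
have [|||A AP] := @certified_algorithm d' n q n ls (fun=> 0%N) f0 finset.set0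
  [set: _]%SET pls lst _ _ f0in.
- apply/fintype.subsetP => x _; apply/cellP => i.
  by rewrite mul0n mul1n/= ltnW// ltn_ord.
- by move=> lsE; rewrite lsE in ls0.
- split; first by move=> x y _; rewrite inE.
  move=> g gin _; have [x gx] := brouwer_fixed_point _ _ g n0 gin.
  by exists x; rewrite ?inE.
exists A => f fin; have [|//] := AP f fin; by move=> x; rewrite inE.
Qed.

(** * Tube flows *)

Section tube.
Variables (d' n M : nat).
Local Notation d := d'.+1.
Local Notation point := (Defs.point d n).
Local Notation top := (@ord_max d').
Local Notation e i := (delta_mx 0 i : 'rV[int]_d).
Implicit Types (x y : point) (Q : nat -> 'I_d -> nat) (H : nat).

Definition height x : nat := coord d n x top.

Definition dev Q x (i : 'I_d) : int := (coord d n x i)%:Z - (Q (height x) i)%:Z.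

Definition off_axis Q (r : nat) x : bool :=
  [exists i, (i != top) && (r%:Z < `|dev Q x i|)].

(* A tube around the graph of [Q] over the last coordinate (the entry
   [Q _ top] is irrelevant): the flow goes up along its core, ends at height
   [H], is directed towards the core in the shell, and goes down outside. On
   the bottom layer, where going down is not allowed, the shell extends to the
   whole layer. *)
Definition tube_flow Q H x : 'rV[int]_d :=
  if (H < height x)%N then - e top else
  if [pick i | (i != top) && (M%:Z < `|dev Q x i|)] is Some i then
    if (0 < height x)%N && off_axis Q (2 * M) x then - e top
    else if 0 < dev Q x i then - e i else e i
  else if height x == H then 0 else e top.

Lemma off_axisP Q (r : nat) x :
  reflect (exists2 i, i != top & r%:Z < `|dev Q x i|) (off_axis Q r x).
Proof.
apply: (iffP existsP) => [[i /andP[it ri]]|[i it ri]]; exists i => //.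
by rewrite it.
Qed.

Lemma off_axisPn Q (r : nat) x :
  reflect (forall i, i != top -> `|dev Q x i| <= r%:Z) (~~ off_axis Q r x).
Proof.
apply: (iffP idP) => [nr i it|dr].
  by rewrite leNgt; apply: contra nr => ri; apply/off_axisP; exists i.
by apply/off_axisP => -[i /dr + ri]; rewrite leNgt ri.
Qed.

(** Abstracts from the choice made by [pick], keeping the sign of the deviation along the chosen
    coordinate. *)
Variant tube_flow_spec Q H x : 'rV[int]_d -> Prop :=
| TubeDown of (H < height x)%N || (0 < height x)%N && off_axis Q (2 * M) x :
    tube_flow_spec Q H x (- e top)
| TubeLeft i of (i != top) & M%:Z < dev Q x i : tube_flow_spec Q H x (- e i)
| TubeRight i of (i != top) & dev Q x i < - M%:Z : tube_flow_spec Q H x (e i)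
| TubeEnd of height x = H & ~~ off_axis Q M x : tube_flow_spec Q H x 0
| TubeUp of (height x < H)%N & ~~ off_axis Q M x : tube_flow_spec Q H x (e top).

Lemma tube_flowP Q H x : tube_flow_spec Q H x (tube_flow Q H x).
Proof.
rewrite /tube_flow; case: ltnP => [Hx|xH]; first by apply: TubeDown; rewrite Hx.
case: pickP => [i /andP[it Mi]|noM].
  case: ifP => [xo|_]; first by apply: TubeDown; rewrite xo orbT.
  case: ltP => di; first by apply: TubeLeft => //; lia.
  by apply: TubeRight => //; lia.
have no : ~~ off_axis Q M x by apply/existsPn => i; rewrite noM.
case: eqP => [xE|/eqP xE]; first exact: TubeEnd.
by apply: TubeUp => //; rewrite ltn_neqAle xE.
Qed.

Lemma tube_flow_top Q H x : (0 < height x)%N ->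
  (H < height x)%N || off_axis Q (2 * M) x -> tube_flow Q H x = - e top.
Proof.
rewrite /tube_flow => x0; case: ltnP => //= _ xo.
case: pickP => [i _|noM]; first by rewrite x0 xo.
by case/off_axisP : xo => i it ri; have := noM i; rewrite it/=; lia.
Qed.

Lemma eq_tube_flow Q Q' H H' x :
  (height x < H)%N -> (height x < H')%N -> Q (height x) = Q' (height x) ->
  tube_flow Q H x = tube_flow Q' H' x.
Proof.
move=> xH xH' QQ'.
have dd i : dev Q x i = dev Q' x i by rewrite /dev QQ'.
rewrite /tube_flow !ltnNge !(ltnW xH) !(ltnW xH') /= !ltn_eqF//.
have -> : off_axis Q (2 * M) x = off_axis Q' (2 * M) x.
  by apply: eq_existsb => i; rewrite dd.
rewrite (_ : [pick i | _] = [pick i | (i != top) && (M%:Z < `|dev Q' x i|)]); last first.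
  by apply: eq_pick => i; rewrite dd.
by case: pickP => // i _; rewrite dd.
Qed.

Lemma tube_flow_eq0 Q H x : tube_flow Q H x = 0 -> height x = H.
Proof.
have e0 i : e i <> 0.
  by move=> /rowP/(_ i); rewrite !mxE !eqxx.
by case: tube_flowP => // [_|i _ _|i _ _|_ _] /eqP; rewrite ?oppr_eq0 => /eqP/e0.
Qed.

(** All entries are -1, 0 or 1, so it suffices that adjacent points never have opposite entries. The
    slope is at most [L < M], hence their deviations differ by at most [M]. Opposite entries need a
    larger gap, from [-M] to [M] or from [M] to [2 * M], or heights on both sides of [H]. *)
Lemma tube_flow_inputs (L : nat) Q H : (L < M)%N -> (H < n)%N ->
  (forall h i, (Q h i <= Q h.+1 i <= Q h i + L)%N) ->
  (forall h i, (Q h i < n)%N) ->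
  brouwer_inputs (tube_flow Q H).
Proof.
move=> LM Hn QL Qn.
have Qdev x y i : adjacent d n x y -> `|dev Q x i - dev Q y i| <= M%:Z.
  move=> xy; have := xy i; have := xy top; rewrite /dev -!/(height _).
  case: (ltngtP (height x) (height y)) => [h|h|->]; last by lia.
    move=> hh; have -> : height y = (height x).+1 by lia.
    by have := QL (height x) i; lia.
  move=> hh; have -> : height x = (height y).+1 by lia.
  by have := QL (height y) i; lia.
have one x i : tube_flow Q H x 0 i = 1 ->
    if i == top then (height x < H)%N && ~~ off_axis Q M x
    else dev Q x i < - M%:Z.
  case: tube_flowP => [_|j _ _|j jt dj|_ _|xH no]; rewrite !mxE//=.
  - by case: eqP.
  - by case: eqP.
  - by case: (i =P j) => // -> _; rewrite (negPf jt).
  - by case: eqP => // _ _; rewrite xH.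
have mone x i : tube_flow Q H x 0 i = -1 ->
    if i == top then (H < height x)%N || (0 < height x)%N && off_axis Q (2 * M) x
    else M%:Z < dev Q x i.
  case: tube_flowP => [xd|j jt dj|j _ _|_ _|_ _]; rewrite !mxE//=.
  - by case: eqP.
  - by case: (i =P j) => // -> _; rewrite (negPf jt).
  - by case: eqP.
  - by case: eqP.
have vals x i : [\/ tube_flow Q H x 0 i = 0, tube_flow Q H x 0 i = 1 |
    tube_flow Q H x 0 i = -1].
  case: tube_flowP => [_|j _ _|j _ _|_ _|_ _]; rewrite !mxE/= ?eqxx;
    try (case: (i =P _) => _ /=); by [constructor 1 | constructor 2 | constructor 3].
split.
- move=> x; case: tube_flowP => [_|j _ _|j _ _|_ _|_ _]; [right|right|right|left|right] => //.
  + by exists top; right.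
  + by exists j; right.
  + by exists j; left.
  + by exists top; left.
- move=> x i; rewrite !mxE -/(coord d n x i).
  have xn : (coord d n x i < n)%N by exact: ltn_ord.
  have tn : (coord d n x top < n)%N by exact: ltn_ord.
  case: (vals x i) => fi; rewrite fi; first by lia.
    have := one _ _ fi; case: eqP => [->|_]; first by move=> /andP[+ _]; rewrite /height; lia.
    by rewrite /dev; have := Qn (height x) i; lia.
  have := mone _ _ fi; case: eqP => [->|_].
    by case/orP => [|/andP[+ _]]; rewrite /height; lia.
  by rewrite /dev; lia.
apply/direction_preservingP => x y xy i.
have yx : adjacent d n y x by move=> j; have := xy j; lia.
have excl u v : adjacent d n u v -> tube_flow Q H u 0 i = 1 ->
    tube_flow Q H v 0 i = -1 -> False.
  move=> uv /one + /mone; case: eqP => [it|_].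
    move=> /andP[uH /off_axisPn no] /orP[|/andP[_ /off_axisP[j jt vj]]].
      by have := uv top; rewrite -!/(height _); lia.
    by have := no j jt; have := Qdev _ _ j uv; lia.
  by have := Qdev _ _ i uv; lia.
have := excl x y xy; have := excl y x yx.
by case: (vals x i) => ->; case: (vals y i) => -> // E1 E2;
  exfalso; (try exact: E1); exact: E2.
Qed.

End tube.

(** * Random tubes *)

Section random_tube.
Variables (d' n M : nat).
Local Notation d := d'.+1.
Local Notation point := (Defs.point d n).
Local Notation top := (@ord_max d').
Local Notation axis := ((nat -> 'I_d -> nat) * nat)%type.
Implicit Types (p r : axis) (x z : point).

(** The added drift starts at the old end height, has slope at most 1 and reaches the offset [u]
    within [l] steps; [u top] varies the new end height as well. *)
Definition extend p (l : nat) (u : {ffun 'I_d -> 'I_l}) : axis :=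
  (fun h i => p.1 h i + minn (h - p.2) (u i), p.2 + l + u top)%N.

(* The box sides are [belast l ls]. The second end height in the base case is
   the random bit that remains unknown to the algorithm. *)
Fixpoint axis_sum (V : nmodType) (l : nat) (ls : seq nat) p (F : axis -> V) : V :=
  if ls is s :: ls' then
    \sum_(u : {ffun 'I_d -> 'I_l}) axis_sum V s ls' (extend p l u) F
  else F p + F (p.1, p.2.+1).

Fixpoint axis_ext (l : nat) (ls : seq nat) p r : Prop :=
  if ls is s :: ls' then
    exists u : {ffun 'I_d -> 'I_l}, axis_ext s ls' (extend p l u) r
  else r = p \/ r = (p.1, p.2.+1).

Definition num_axes (l : nat) (ls : seq nat) : nat :=
  (2 * \prod_(s <- belast l ls) s ^ d)%N.

Lemma num_axes_cons (l s : nat) (ls : seq nat) :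
  num_axes l (s :: ls) = (l ^ d * num_axes s ls)%N.
Proof. by rewrite /num_axes /= big_cons mulnCA. Qed.

Lemma card_box (l : nat) : #|{: {ffun 'I_d -> 'I_l}}| = (l ^ d)%N.
Proof. by rewrite card_ffun !card_ord. Qed.

Lemma axis_sum_const (V : nmodType) (l : nat) (ls : seq nat) p (c : V) :
  axis_sum V l ls p (fun=> c) = c *+ num_axes l ls.
Proof.
elim: ls l p => [|s ls IH] l p /=; first by rewrite /num_axes big_nil muln1 mulr2n.
under eq_bigr => u _ do rewrite IH.
by rewrite sumr_const card_box num_axes_cons mulnC mulrnA.
Qed.

Lemma axis_sumD (V : nmodType) (l : nat) (ls : seq nat) p (F G : axis -> V) :
  axis_sum V l ls p (fun r => F r + G r) = axis_sum V l ls p F + axis_sum V l ls p G.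
Proof.
elim: ls l p => [|s ls IH] l p /=; first by rewrite addrACA.
by rewrite -big_split/=; apply: eq_bigr => u _; exact: IH.
Qed.

Lemma axis_sum_sum (V : nmodType) (l : nat) (ls : seq nat) p (I : Type)
    (zs : seq I) (F : I -> axis -> V) :
  axis_sum V l ls p (fun r => \sum_(z <- zs) F z r) =
  \sum_(z <- zs) axis_sum V l ls p (F z).
Proof.
elim: ls l p => [|s ls IH] l p /=; first by rewrite big_split.
by rewrite exchange_big/=; apply: eq_bigr => u _; exact: IH.
Qed.

Lemma ler_axis_sum (R : numDomainType) (l : nat) (ls : seq nat) p
    (F G : axis -> R) : (forall r, axis_ext l ls p r -> F r <= G r) ->
  axis_sum R l ls p F <= axis_sum R l ls p G.
Proof.
elim: ls l p => [|s ls IH] l p /= FG.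
  by apply: lerD; apply: FG; [left|right].
by apply: ler_sum => u _; apply: IH => r ur; apply: FG; exists u.
Qed.

Lemma axis_ext_prefix (l : nat) (ls : seq nat) p r : axis_ext l ls p r ->
  (p.2 <= r.2)%N /\ forall h, (h <= p.2)%N -> r.1 h = p.1 h.
Proof.
elim: ls l p => [|s ls IH] l p /=; first by case=> ->.
move=> [u /IH[/= pr rE]]; split; first by lia.
move=> h hp; rewrite rE; last by lia.
apply/funext => i; lia.
Qed.

(** Each segment adds at most 1 to the slope, which the radius [M] has to exceed. *)
Lemma axis_ext_lipschitz (l : nat) (ls : seq nat) (L : nat) p r :
  axis_ext l ls p r ->
  (forall h i, (p.1 h i <= p.1 h.+1 i <= p.1 h i + L)%N) ->
  forall h i, (r.1 h i <= r.1 h.+1 i <= r.1 h i + (L + size ls))%N.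
Proof.
elim: ls l p L => [|s ls IH] l p L /=; first by rewrite addn0; case=> ->.
move=> [u /IH {}IH] pL h i; rewrite -addSnnS; apply: IH => {}h {}i /=.
by have := pL h i; lia.
Qed.

Lemma axis_ext_bounded (l : nat) (ls : seq nat) p r : axis_ext l ls p r ->
  (r.2 <= p.2 + 2 * sumn (belast l ls) + 1)%N /\
  forall h i, (r.1 h i <= p.1 h i + sumn (belast l ls))%N.
Proof.
elim: ls l p => [|s ls IH] l p /=.
  by case=> -> /=; split => [|h i]; lia.
move=> [u /IH[/= pr rE]]; split; first by have := ltn_ord (u top); lia.
by move=> h i; have := rE h i; have := ltn_ord (u i); lia.
Qed.

Local Notation flow r := (tube_flow d' n M r.1 r.2).

(* [z] reveals part of the axis [r] above height [h]. *)
Definition hits z (h : nat) r : bool :=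
  (h <= height d' n z <= r.2)%N && ~~ off_axis d' n r.1 (2 * M) z.

(** The answers predicted from the known part [p] of the axis. *)
Definition blind_flow p z : 'rV[int]_d :=
  if (height d' n z < p.2)%N then flow p z else - delta_mx 0 top.

(** Below the end of [p] only the prefix matters. Above it, a miss is outside the tube or above its
    end, where the flow goes down; height 0 is excluded because the shell extends over the bottom
    layer. *)
Lemma flow_no_hit (l : nat) (ls : seq nat) p r z : (0 < p.2)%N ->
  axis_ext l ls p r -> ~~ hits z p.2 r -> flow r z = blind_flow p z.
Proof.
move=> p0 /axis_ext_prefix[pr rp]; rewrite /hits /blind_flow.
case: ltnP => /= [zp _|pz].
  by apply: eq_tube_flow; rewrite ?rp ?(leq_trans zp)// ltnW.
rewrite negb_and negbK -ltnNge => zr; apply: tube_flow_top => //.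
exact: leq_trans pz.
Qed.

(* The shift [t] is the effect at [z] of the segment after [u]. *)
Definition near_axis (l s : nat) p z (t : nat -> 'I_d -> nat) :
    {set {ffun 'I_d -> 'I_l}} :=
  [set u : {ffun 'I_d -> 'I_l} |
     (p.2 + l + u top <= height d' n z <= p.2 + l + u top + 2 * s)%N &&
     [forall i, (i != top) ==>
       (`|(coord d n z i)%:Z - (p.1 (height d' n z) i + u i + t (u top) i)%N%:Z|
          <= (2 * M)%N%:Z)%R]].

Lemma near_axisP (l s : nat) p z (t : nat -> 'I_d -> nat) (u : {ffun 'I_d -> 'I_l}) :
  reflect ((p.2 + l + u top <= height d' n z <= p.2 + l + u top + 2 * s)%N /\
    forall i, i != top ->
      `|(coord d n z i)%:Z - (p.1 (height d' n z) i + u i + t (u top) i)%N%:Z|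
        <= (2 * M)%N%:Z)
    (u \in near_axis l s p z t).
Proof.
rewrite inE; apply: (iffP andP) => -[uh ui]; split => //.
  by move=> i it; move/forallP/(_ i)/implyP : ui; apply.
by apply/forallP => i; apply/implyP; exact: ui.
Qed.

(** The height of [z] leaves [2 * s + 1] values for [u top]. This fixes the shift, and each other
    coordinate of [z] then leaves at most [4 * M + 1] values. *)
Lemma card_near_axis (l s : nat) p z (t : nat -> 'I_d -> nat) :
  (#|near_axis l s p z t| <= (2 * s).+1 * (4 * M).+1 ^ d)%N.
Proof.
set E := near_axis _ _ _ _ _.
pose phi (u : {ffun 'I_d -> 'I_l}) : 'I_(2 * s).+1 * {ffun 'I_d -> 'I_(4 * M).+1} :=
  (inord (height d' n z - (p.2 + l + u top)),
   [ffun i => inord (p.1 (height d' n z) i + u i + t (u top) i + 2 * M - coord d n z i)]).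
have phi_inj : {in E &, injective phi}.
  have aux (a b c f m : nat) : `|c%:Z - (f + a + m)%N%:Z| <= (2 * M)%N%:Z ->
      `|c%:Z - (f + b + m)%N%:Z| <= (2 * M)%N%:Z ->
      [/\ (f + a + m + 2 * M - c < (4 * M).+1)%N,
          (f + b + m + 2 * M - c < (4 * M).+1)%N &
          (f + a + m + 2 * M - c = f + b + m + 2 * M - c)%N -> a = b].
    by move=> ? ?; split; lia.
  move=> u v /near_axisP[uh ui] /near_axisP[vh vi].
  move=> -[/(congr1 val)/= uvt uvi].
  have uvtop : u top = v top.
    by apply/val_inj => /=; move: uvt; rewrite !inordK; lia.
  apply/ffunP => i; have [->//|it] := eqVneq i top.
  move: uvi => /ffunP/(_ i); rewrite !ffunE => /(congr1 val)/=.
  have := ui i it; have := vi i it; rewrite uvtop => vi' ui'.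
  have [uM vM uvE] := aux _ _ _ _ _ ui' vi'.
  by rewrite !inordK// => /uvE/val_inj.
rewrite -(card_in_imset phi_inj) (leq_trans (max_card _))//.
by rewrite card_prod card_ffun !card_ord.
Qed.

Lemma ler_bool (R : numDomainType) (b c : bool) : (b -> c) -> b%:R <= c%:R :> R.
Proof. by case: b; case: c => // /(_ isT). Qed.

(** A hit above the end of the segment [u] is either along the next segment, which leaves few values
    for [u], or beyond it, where induction applies. So each unknown segment contributes probability
    at most [eps]. *)
Lemma hits_count (R : realFieldType) (eps : R) (l s : nat) (ls : seq nat) p z :
  path (fun l s => (0 < s)%N &&
    (((2 * s).+1 * (4 * M).+1 ^ d)%:R <= eps * (l ^ d)%:R)) l (s :: ls) ->
  \sum_(u : {ffun 'I_d -> 'I_l}) axis_sum R s ls (extend p l u)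
    (fun r => (hits z (extend p l u).2 r)%:R) <=
  eps * (size (s :: ls))%:R * (num_axes l (s :: ls))%:R.
Proof.
have sumE (T : finType) (E : {set T}) : \sum_u (u \in E)%:R = #|E|%:R :> R.
  rewrite -sum1_card natr_sum [RHS]big_mkcond; apply: eq_bigr => u _.
  by case: (u \in E).
elim: ls l s p => [|s' ls IH] l s p.
  rewrite [path _ _ _]/= andbT => /andP[s0 ls_eps].
  have Ecard := card_near_axis l s p z (fun _ _ => 0%N).
  set E := near_axis _ _ _ _ _ in Ecard.
  (* Only the two possible end heights remain; both fit into the window [2 * s] as [s] is
     positive. *)
  apply: (@le_trans _ _ (\sum_(u : {ffun 'I_d -> 'I_l}) (u \in E)%:R *+ 2)).
    apply: ler_sum => u _; rewrite mulr2n.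
    have uE r : r.1 = (extend p l u).1 -> (r.2 <= (extend p l u).2.+1)%N ->
        hits z (extend p l u).2 r -> u \in E.
      rewrite /hits => rE rle /andP[/= zh /off_axisPn zo].
      apply/near_axisP; split => [|i it]; first by move: rle zh => /=; lia.
      have := zo i it; rewrite /dev rE/= addn0.
      have pz : (p.2 + l <= height d' n z)%N.
        by apply: leq_trans (leq_addr (u top) _) _; case/andP: zh.
      rewrite (minn_idPr _)// (leq_trans (ltnW (ltn_ord (u i))))//.
      by clear -pz; lia.
    by apply: lerD; apply: ler_bool; exact: uE.
  rewrite sumrMnl sumE num_axes_cons /num_axes big_nil muln1 mulr1 natrM.
  rewrite mulrA mulr_natr lerMn2r /=.
  by rewrite (le_trans _ ls_eps)// ler_nat.
move=> /andP[/andP[s0 ls_eps] pls].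
(* [u] is counted with [u'] fixed, hence the exchange of sums below. *)
pose E (u' : {ffun 'I_d -> 'I_s}) := near_axis l s p z
  (fun a i => minn (height d' n z - (p.2 + l + a)) (u' i)).
apply: (@le_trans _ _ (\sum_(u : {ffun 'I_d -> 'I_l}) \sum_(u' : {ffun 'I_d -> 'I_s})
   ((u \in E u')%:R *+ num_axes s' ls + axis_sum R s' ls (extend (extend p l u) s u')
     (fun r => (hits z (extend (extend p l u) s u').2 r)%:R)))).
  apply: ler_sum => u _; apply: ler_sum => u' _.
  rewrite -(axis_sum_const _ _ _ (extend (extend p l u) s u')) -axis_sumD.
  apply: ler_axis_sum => r /axis_ext_prefix[ur rE].
  have [zr|] := boolP (hits z (extend (extend p l u) s u').2 r).
    by rewrite ler_wpDl// ler_nat leq_b1.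
  rewrite addr0 => nzr; apply: ler_bool => zr.
  move: (zr) nzr; rewrite /hits => /andP[/andP[zh ->] zo].
  rewrite zo !andbT -ltnNge => hz; move/off_axisPn : zo => zo.
  apply/near_axisP; split => [|i it].
    move: zh hz (ltn_ord (u' top)) => /=; clear.
    by move: (nat_of_ord (u top)) (nat_of_ord (u' top)); lia.
  have := zo i it; rewrite /dev rE/=; last exact: ltnW.
  have pz : (p.2 + l <= height d' n z)%N.
    exact: leq_trans (leq_addr (u top) _) zh.
  rewrite (@minn_idPr (height d' n z - p.2) (u i) _)//.
  by rewrite (leq_trans (ltnW (ltn_ord (u i))))//; clear -pz; lia.
under eq_bigr => u _ do rewrite big_split/=.
rewrite big_split/= exchange_big/=.
set N := num_axes l _; have NE : N%:R = (l ^ d)%:R * (num_axes s (s' :: ls))%:R :> R.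
  by rewrite /N num_axes_cons natrM.
rewrite [X in _ * X%:R * _](_ : _ = 1 + size (s' :: ls))%N//.
rewrite natrD mulrDr mulrDl mulr1; apply: lerD.
  apply: (@le_trans _ _ (\sum_(u' : {ffun 'I_d -> 'I_s})
      (eps * (l ^ d)%:R) *+ num_axes s' ls)).
    apply: ler_sum => u' _; rewrite sumrMnl sumE lerMn2r; apply/orP; right.
    by rewrite (le_trans _ ls_eps)// ler_nat card_near_axis.
  rewrite sumr_const card_box -mulrnA mulnC -num_axes_cons -mulr_natr NE.
  by rewrite mul1r mulrA !mulr_natr.
apply: (@le_trans _ _ (\sum_(u : {ffun 'I_d -> 'I_l})
    eps * (size (s' :: ls))%:R * (num_axes s (s' :: ls))%:R)).
  by apply: ler_sum => u _; exact: IH.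
by rewrite sumr_const card_box NE -[leLHS]mulr_natl mulrCA.
Qed.

Lemma zero_round_output (Q Ans Out : Type) (A : algorithm Q Ans Out 0) :
  exists o, forall f, output A f = o.
Proof.
refine (match A as A' in algorithm _ _ _ k' return
  match k' as k' return algorithm Q Ans Out k' -> Prop with
  | 0 => fun A' => exists o, forall f, output A' f = o
  | _.+1 => fun=> True
  end A' with Output k' o => _ | Round _ _ _ _ => I end).
by case: k' => //=; exists o.
Qed.

Lemma algorithm_roundP (Q Ans Out : Type) (k : nat)
    (P : algorithm Q Ans Out k.+1 -> Prop) :
  (forall o, P (Output _ _ k.+1 o)) ->
  (forall m (qs : m.-tuple Q) next, P (Round qs next)) -> forall A, P A.
Proof.
move=> PO PR A.
refine (match A as A' in algorithm _ _ _ k' return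
  match k' as k' return algorithm Q Ans Out k' -> Prop with
  | 0 => fun=> True
  | k0.+1 => fun A' => forall P : algorithm Q Ans Out k0.+1 -> Prop,
     (forall o, P (Output _ _ k0.+1 o)) ->
     (forall m (qs : m.-tuple Q) next, P (Round qs next)) -> P A'
  end A' with Output k' o => _ | Round k' m qs next => _ end P PO PR).
- by case: k' o => // k' o P' H _; exact: H.
- by move=> P' _; exact.
Qed.

(** Each query hits with probability at most [eps] per unknown segment. If the first round has no
    hit, its answers are those of [blind_flow]; even if the segment [u] is then given away, one
    round and one segment fewer remain. Without rounds the output is fixed and right for at most one
    of the two end heights, hence 1/2. *)
Lemma success_bound (R : realFieldType) (eps : R) (l : nat) (ls : seq nat) p
    (A : algorithm point 'rV[int]_d point (size ls)) (q : nat) :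
  0 <= eps -> (0 < l)%N ->
  path (fun l s => (0 < s)%N &&
    (((2 * s).+1 * (4 * M).+1 ^ d)%:R <= eps * (l ^ d)%:R)) l ls ->
  axis_sum R l ls p (fun r =>
    ((flow r (output A (flow r)) == 0) && (num_queries A (flow r) <= q)%N)%:R) <=
  (1 / 2 + eps * (size ls)%:R * q%:R) * (num_axes l ls)%:R.
Proof.
move=> eps0; elim: ls l p A q => [|s ls IH] l p A q l0 lsP.
  have [out Ao] := zero_round_output _ _ _ A.
  rewrite /= /num_axes big_nil muln1 mulr0 mul0r addr0 divfK//.
  rewrite !Ao; set b1 := (X in (nat_of_bool X)%:R + _);
  set b2 := (X in _ + (nat_of_bool X)%:R).
  have : ~~ (b1 && b2).
    apply/negP => /andP[/andP[/eqP/tube_flow_eq0 + _] /andP[/eqP/tube_flow_eq0 + _]].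
    by move=> ->; lia.
  by case: b1 b2 => [] [] //= _; rewrite ?addr0 ?add0r ?ler01.
have s0 : (0 < s)%N by case/andP: lsP => /andP[].
have lsP' : path (fun l s => (0 < s)%N &&
    (((2 * s).+1 * (4 * M).+1 ^ d)%:R <= eps * (l ^ d)%:R)) s ls.
  by case/andP: lsP.
have bound_sum q' :
    \sum_(u : {ffun 'I_d -> 'I_l})
      (1 / 2 + eps * (size ls)%:R * q'%:R) * (num_axes s ls)%:R =
    (1 / 2 + eps * (size ls)%:R * q'%:R) * (num_axes l (s :: ls))%:R.
  by rewrite sumr_const card_box num_axes_cons natrM -[LHS]mulr_natl mulrCA.
move: A; apply: algorithm_roundP => [out|m qs next].
  (* An algorithm that stops at once is also one with a round fewer, for each [u]. *)
  apply: (@le_trans _ _ (\sum_(u : {ffun 'I_d -> 'I_l})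
      (1 / 2 + eps * (size ls)%:R * q%:R) * (num_axes s ls)%:R)).
    by apply: ler_sum => u _; exact: (IH s _ (Output _ _ _ out)).
  rewrite bound_sum ler_wpM2r// lerD2l ler_wpM2r// ler_wpM2l// ler_nat.
  exact: leqnSn.
have [mq|qm] := leqP m q; last first.
  apply: (@le_trans _ _ 0).
    rewrite -[leRHS](mul0rn _ (num_axes l (s :: ls))) -(axis_sum_const _ _ _ p).
    apply: ler_axis_sum => r _; rewrite (_ : (_ && _) = false)//.
    by apply/negP => /andP[_] /=; lia.
  by rewrite mulr_ge0// addr_ge0// ?divr_ge0// !mulr_ge0.
(* The continuation when the first segment is [u] and no query has hit. *)
pose A' u := next (map_tuple (blind_flow (extend p l u)) qs).
apply: (@le_trans _ _ (\sum_(u : {ffun 'I_d -> 'I_l})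
    axis_sum R s ls (extend p l u) (fun r =>
     \sum_(z <- qs) (hits z (extend p l u).2 r)%:R +
     ((flow r (output (A' u) (flow r)) == 0) &&
      (num_queries (A' u) (flow r) <= q - m)%N)%:R))).
  apply: ler_sum => u _; apply: ler_axis_sum => r ur.
  have [/hasP[z zqs zr]|/hasPn nohit] := boolP (has (fun z => hits z (extend p l u).2 r) qs).
    apply: ler_wpDr; first by [].
    rewrite (big_rem z)//= zr (@le_trans _ _ 1)//; first by rewrite lern1 leq_b1.
    by rewrite lerDl sumr_ge0.
  have eq_ans : map_tuple (flow r) qs = map_tuple (blind_flow (extend p l u)) qs.
    apply/val_inj/eq_in_map => z zqs; apply: flow_no_hit ur (nohit z zqs).
    by rewrite /=; lia.
  apply: ler_wpDl; first by rewrite sumr_ge0.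
  apply: ler_bool => /=; rewrite eq_ans -/(A' u) => /andP[-> /=].
  by rewrite leq_subRL.
under eq_bigr => u _ do rewrite axis_sumD axis_sum_sum.
rewrite big_split/= exchange_big/=.
apply: (@le_trans _ _ (\sum_(z <- qs) eps * (size (s :: ls))%:R * (num_axes l (s :: ls))%:R +
  \sum_(u : {ffun 'I_d -> 'I_l})
    (1 / 2 + eps * (size ls)%:R * (q - m)%:R) * (num_axes s ls)%:R)).
  apply: lerD; first by apply: ler_sum => z _; exact: hits_count.
  by apply: ler_sum => u _; exact: IH.
rewrite bound_sum big_const_seq count_predT size_tuple iter_addr_0.
rewrite -mulr_natl natrB// -subr_ge0 [size (s :: ls)]/= -natr1.
set S := (size ls)%:R; set N := (num_axes l _)%:R.
rewrite (_ : _ - _ = N * eps * (q%:R - m%:R)); last by ring.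
by rewrite !mulr_ge0// subr_ge0 ler_nat.
Qed.

End random_tube.

(** * Randomized algorithms *)

Section randomized.
Variables (R : realType) (d' n : nat).
Local Notation d := d'.+1.
Local Notation point := (Defs.point d n).
Local Notation axis := ((nat -> 'I_d -> nat) * nat)%type.
Variables (disp : measure_display) (T : measurableType disp) (P : probability T R).

Lemma axis_sum_EFin (l : nat) (ls : seq nat) (p : axis) (F : axis -> R) :
  axis_sum d' (\bar R) l ls p (fun r => (F r)%:E) = (axis_sum d' R l ls p F)%:E.
Proof.
elim: ls l p => //= s ls IH l p; rewrite -sumEFin.
by apply: eq_bigr => u _; exact: IH.
Qed.

Lemma lee_axis_sum (l : nat) (ls : seq nat) (p : axis) (F G : axis -> \bar R) :
  (forall r, axis_ext d' l ls p r -> (F r <= G r)%E) ->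
  (axis_sum d' (\bar R) l ls p F <= axis_sum d' (\bar R) l ls p G)%E.
Proof.
elim: ls l p => [|s ls IH] l p /= FG.
  by apply: leeD; apply: FG; [left|right].
by apply: lee_sum => u _; apply: IH => r ur; apply: FG; exists u.
Qed.

(** Linearity of the integral; measurability and sign join the induction because each step uses
    them. *)
Lemma integral_axis_sum (l : nat) (ls : seq nat) (p : axis) (S : axis -> set T) :
  (forall r, axis_ext d' l ls p r -> measurable (S r)) ->
  let F (w : T) : \bar R :=
    axis_sum d' (\bar R) l ls p (fun r => (\1_(S r) w : R)%:E) in
  [/\ measurable_fun [set: T] F, forall w, (0 <= F w)%E &
  (\int[P]_w F w = axis_sum d' (\bar R) l ls p (fun r => P (S r)))%E].
Proof.
elim: ls l p => [|s ls IH] l p mS /=.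
  have m1 r : r = p \/ r = (p.1, p.2.+1) ->
      measurable_fun [set: T] (fun w => (\1_(S r) w : R)%:E).
    by move=> rp; apply/measurable_EFinP/measurable_indic; exact: mS.
  split.
  - by apply: emeasurable_funD; apply: m1; [left|right].
  - by move=> w; rewrite adde_ge0// lee_fin.
  have i0 r w : [set: T] w -> (0 <= (\1_(S r) w : R)%:E)%E by rewrite lee_fin.
  rewrite (ge0_integralD _ measurableT (i0 _) (m1 _ (or_introl erefl)) (i0 _)
    (m1 _ (or_intror erefl))).
  by rewrite !integral_indic ?setIT//; apply: mS; [right|left].
have {}IH u := IH s (extend d' p l u) (fun r ur => mS r (ex_intro _ u ur)).
split.
- by apply: emeasurable_sum => u; case: (IH u).
- by move=> w; rewrite sume_ge0// => u _; case: (IH u).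
rewrite ge0_integral_sum//; last 2 first.
- by move=> u; case: (IH u).
- by move=> u w _; case: (IH u).
by apply: eq_bigr => u _; case: (IH u).
Qed.

Variables (k : nat) (A : T -> algorithm point 'rV[int]_d point k).
Hypothesis Acorrect :
  rand_correct (@brouwer_inputs d n) (@fixed_points d n) P A.

Definition fast_success (q : nat) (f : point -> 'rV[int]_d) : set T :=
  [set w | (f (output (A w) f) == 0) && (num_queries (A w) f <= q)%N].

(** By Markov's inequality, more than [q] queries occur with probability at most [C / q.+1]. *)
Lemma fast_success_prob (q : nat) (C : R) (f : point -> 'rV[int]_d) :
  brouwer_inputs f -> ('E_P[fun w => (num_queries (A w) f)%:R] <= C%:E)%E ->
  measurable (fast_success q f) /\
  ((2 / 3 - C / q.+1%:R)%:E <= P (fast_success q f))%E.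
Proof.
move=> /Acorrect[mX mS PS] EC; set X := fun w => _ in mX.
pose slow := [set w | (q < num_queries (A w) f)%N].
have mslow : measurable slow.
  rewrite (_ : slow = [set: T] `&` X @^-1` [set` `[q.+1%:R, +oo[]).
    exact: mX.
  apply/seteqP; split => w /=; rewrite in_itv/= andbT ler_nat//.
  by case.
have fastE : fast_success q f = [set w | fixed_points f (output (A w) f)] `\` slow.
  apply/seteqP; split => w /=.
    by move=> /andP[/eqP fw]; rewrite leqNgt => /negP.
  move=> [fw nslow]; apply/andP; split; first exact/eqP.
  by rewrite leqNgt; exact/negP.
have mfast : measurable (fast_success q f) by rewrite fastE; exact: measurableD.
split=> //.
have Pslow : (P slow <= (C / q.+1%:R)%:E)%E.
  rewrite EFinM lee_pdivlMr ?ltr0n// (le_trans _ EC)// muleC.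
  rewrite unlock -[X in P X]setIT -integral_indic// -ge0_integralZl_EFin//; last first.
    exact/measurable_EFinP/measurable_indic.
  apply: ge0_le_integral => //.
  - apply: emeasurable_funM => //; exact/measurable_EFinP/measurable_indic.
  - exact/measurable_EFinP.
  move=> w _; rewrite -EFinM lee_fin indicE.
  by case: (boolP (w \in slow)); rewrite ?mulr1 ?mulr0// inE /slow/= ler_nat.
have : ((2 / 3)%:E <= P (fast_success q f) + P slow)%E.
  apply: (le_trans PS); apply: le_trans (measureU2 P mfast mslow).
  apply: le_measure; rewrite ?inE//; first exact: measurableU.
  by move=> w fw; rewrite fastE; have [ws|ws] := pselect (slow w); [right|left].
have /fineK <- : P (fast_success q f) \is a fin_num by exact: fin_num_measure.
have /fineK Pf : P slow \is a fin_num by exact: fin_num_measure.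
move: Pslow; rewrite -Pf -EFinD !lee_fin; move: (C / _) => c; lra.
Qed.

End randomized.

Lemma num_axes_gt0 (d' l : nat) (ls : seq nat) : all (leq 1) (l :: ls) ->
  (0 < num_axes d' l ls)%N.
Proof.
elim: ls l => [|s ls IH] l; first by rewrite /num_axes big_nil.
move=> /andP[l0 /IH]; rewrite num_axes_cons muln_gt0 expn_gt0.
by move: l0 => /= ->.
Qed.

Lemma path_all (T : Type) (e : rel T) (a : pred T) (x : T) (s : seq T) :
  (forall y z, e y z -> a z) -> path e x s -> all a s.
Proof. by move=> ea; elim: s x => //= y s IH x /andP[/ea -> /IH]. Qed.

(** Yao's principle: the average over the axes is exchanged with the integral over the coins, and
    for fixed coins [success_bound] applies to [A w]. *)
Lemma rand_cost_bound (R : realType) (d' n m q : nat) (ls : seq nat) (eps C : R)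
    (disp : measure_display) (T : measurableType disp) (P : probability T R)
    (A : T -> algorithm (Defs.point d'.+1 n) 'rV[int]_d'.+1 (Defs.point d'.+1 n)
      (size ls)) :
  0 <= eps -> (0 < m)%N -> (2 * sumn (belast m ls) + 1 < n)%N ->
  path (fun l s => (0 < s)%N && (((2 * s).+1 * (4 * (size ls).+1).+1 ^ d'.+1)%:R
    <= eps * (l ^ d'.+1)%:R)) m ls ->
  rand_correct (@brouwer_inputs d'.+1 n) (@fixed_points d'.+1 n) P A ->
  (rand_cost (@brouwer_inputs d'.+1 n) P A <= C%:E)%E ->
  2 / 3 - C / q.+1%:R <= 1 / 2 + eps * (size ls)%:R * q%:R.
Proof.
move=> eps0 m0 mn lsP Acor AC.
(* The slope of the axis is at most the number of segments. *)
pose M := (size ls).+1.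
pose p0 : (nat -> 'I_d'.+1 -> nat) * nat := (fun _ _ => 0%N, 0%N).
pose flow r := tube_flow d' n M r.1 r.2.
have fin r : axis_ext d' m ls p0 r -> brouwer_inputs (flow r).
  move=> rp; have [/= r2 r1] := axis_ext_bounded _ _ _ _ _ rp.
  apply: (@tube_flow_inputs _ _ _ (size ls)) => //; first by lia.
    move=> h i; have := axis_ext_lipschitz _ _ _ 0 _ _ rp.
    by rewrite add0n; apply.
  by move=> h i; have := r1 h i; lia.
pose S r := fast_success _ _ _ T _ A q (flow r).
have SP r : axis_ext d' m ls p0 r ->
    measurable (S r) /\ ((2 / 3 - C / q.+1%:R)%:E <= P (S r))%E.
  move=> rp; apply: (fast_success_prob _ _ _ _ _ P _ _ Acor q C); first exact: fin.
  by apply: le_trans AC; apply: ereal_sup_ubound; exists (flow r) => //; exact: fin.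
have mS r (rp : axis_ext d' m ls p0 r) := (SP r rp).1.
have [mF F0 IF] := integral_axis_sum R d' _ T P m ls p0 S mS.
set N := num_axes d' m ls.
have N0 : 0 < N%:R :> R.
  rewrite ltr0n; apply: num_axes_gt0; rewrite /= m0/=.
  by apply: path_all lsP => l s /andP[].
rewrite -(ler_pM2r N0) -lee_fin.
apply: (@le_trans _ _ (axis_sum d' (\bar R) m ls p0 (fun r => P (S r)))).
  rewrite mulr_natr -(axis_sum_const d' R m ls p0) -axis_sum_EFin.
  by apply: lee_axis_sum => r /SP[].
rewrite -IF.
apply: (@le_trans _ _ (\int[P]_w ((1 / 2 + eps * (size ls)%:R * q%:R) * N%:R)%:E)%E).
  apply: ge0_le_integral => //.
  move=> w _; rewrite axis_sum_EFin lee_fin.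
  apply: le_trans (success_bound d' n M R eps m ls p0 (A w) q eps0 m0 lsP).
  by apply: ler_axis_sum => r _; rewrite indicE; apply: ler_bool; rewrite inE.
by rewrite integral_cst//= probability_setT mule1.
Qed.

(** * The sides of the boxes *)

Lemma path_map_iota (e : rel nat) (l : nat -> nat) (i k : nat) :
  (forall j, (i <= j < i + k)%N -> e (l j) (l j.+1)) ->
  path e (l i) [seq l j | j <- iota i.+1 k].
Proof.
elim: k i => //= k IH i el; apply/andP; split; first by apply: el; lia.
by apply: IH => j ij; apply: el; lia.
Qed.

Lemma last_map_iota (l : nat -> nat) (i k : nat) :
  last (l i) [seq l j | j <- iota i.+1 k] = l (i + k)%N.
Proof. by elim: k i => [|k IH] i /=; rewrite ?addn0// IH addSnnS. Qed.

Lemma sumn_belast (m : nat) (ls : seq nat) :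
  path (fun l s => (s <= l)%N) m ls -> (sumn (belast m ls) <= size ls * m)%N.
Proof.
elim: ls m => //= s ls IH m /andP[sm /IH] {}IH.
by rewrite mulSn leq_add2l (leq_trans IH)// leq_mul2l sm orbT.
Qed.

Section scales.
Variables (R : realType) (d k : nat).
Hypotheses (hd : (2 <= d)%N) (hk : (1 <= k)%N).

Definition rate : R := (d%:R ^+ k.+1 - d%:R ^+ k) / (d%:R ^+ k - 1).

Lemma dk_gt1 : 1 < d%:R ^+ k :> R.
Proof. by rewrite exprn_egt1// ?ltr1n// -lt0n. Qed.

Lemma rate_ge0 : 0 <= rate.
Proof.
rewrite divr_ge0// subr_ge0; last exact/ltW/dk_gt1.
by rewrite exprSr ler_peMr ?exprn_ge0// ler1n ltnW.
Qed.

(* The side [l_j] is [n ^ a_j] with [d a_j - a_(j+1)] constant, [a_0 = 1] and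
   [a_k = 0], so that all rounds have the same cost [l_j ^ d / l_(j+1)]. *)
Lemma scales (n : nat) : (0 < n)%N -> exists ls : seq nat,
  [/\ size ls = k, last 1%N ls = 1%N &
   path (fun l s => [&& (0 < s)%N, (s <= l)%N,
     (l ^ d)%:R <= 2 * (n%:R `^ rate) * s%:R :> R &
     (n%:R `^ rate) * s%:R <= (2 ^ d * l ^ d)%N%:R :> R]) n ls].
Proof.
move=> n0; have dk := dk_gt1; have d1 : 1 <= d%:R :> R by rewrite ler1n ltnW.
pose a j : R := (d%:R ^+ k - d%:R ^+ j) / (d%:R ^+ k - 1).
pose x j : R := n%:R `^ a j; pose l j := Num.truncn (x j).
have n1 : 1 <= n%:R :> R by rewrite ler1n.
have a_ge0 j : (j <= k)%N -> 0 <= a j.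
  move=> jk; rewrite divr_ge0// subr_ge0; last exact: ltW.
  exact: ler_weXn2l.
have aS j : a j.+1 <= a j.
  rewrite ler_pM2r ?invr_gt0 ?subr_gt0// lerD2l lerN2.
  by rewrite ler_weXn2l.
have x_ge1 j : (j <= k)%N -> 1 <= x j.
  by move=> jk; rewrite -(powRr0 n%:R) ler_powR// a_ge0.
have xS j : x j ^+ d = n%:R `^ rate * x j.+1.
  rewrite -powR_mulrn ?powR_ge0// -powRrM -powRD; last first.
    by apply/implyP => _; rewrite pnatr_eq0 -lt0n.
  congr (_ `^ _); rewrite /a /rate !exprSr.
  by field; rewrite subr_eq0 gt_eqF.
have l_le j : (l j)%:R <= x j by rewrite truncn_le powR_ge0.
(* Rounding down a number that is at least 1 loses at most a factor 2; this causes the factors [2]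
   and [2 ^ d]. *)
have l_ge j : (j <= k)%N -> x j <= 2 * (l j)%:R.
  move=> /x_ge1 x1; have /andP[_] := truncn_itv (le_trans ler01 x1).
  rewrite -/(l j) -natr1 => xl.
  have : 1 <= (l j)%:R :> R by rewrite ler1n truncn_gt0.
  by move: ((l j)%:R) xl => y; lra.
have X0 : 0 <= n%:R `^ rate :> R by exact: powR_ge0.
have dk0 : d%:R ^+ k - 1 != 0 :> R by rewrite subr_eq0 gt_eqF.
have l0 : l 0%N = n by rewrite /l /x /a expr0 divff// powRr1// natrK.
have lk : l k = 1%N.
  by rewrite /l /x /a subrr mul0r powRr0 -[1]/(1%:R) natrK.
exists [seq l j | j <- iota 1 k]; split.
- by rewrite size_map size_iota.
- by transitivity (l (0 + k)%N) => //; rewrite -last_map_iota; case: (k) hk.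
rewrite -[X in path _ X _]l0; apply: path_map_iota => j /andP[_ jk].
apply/and4P; split.
- by rewrite truncn_gt0 x_ge1.
- by apply: le_truncn; rewrite ler_powR.
- rewrite natrX; apply: (@le_trans _ _ (x j ^+ d)).
    by rewrite lerXn2r ?nnegrE ?powR_ge0.
  by rewrite xS -mulrA mulrCA ler_wpM2l// l_ge.
- apply: (@le_trans _ _ (x j ^+ d)); first by rewrite xS ler_wpM2l.
  rewrite natrM !natrX -exprMn lerXn2r ?nnegrE ?powR_ge0 ?mulr_ge0//.
  by rewrite l_ge// ltnW.
Qed.

End scales.

(** * The upper and the lower bound *)

Lemma rand_le_det (R : realType) (Q Ans Out : Type) (inputs : set (Q -> Ans))
    (sol : (Q -> Ans) -> set Out) (k : nat) :
  (rand_query_complexity R inputs sol k <= det_query_complexity R inputs sol k)%E.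
Proof.
apply/ereal_infP => _ [A Acor <-]; apply: ereal_inf_lbound => /=.
exists _, unit, (dirac tt), (fun=> A); split.
  move=> f fin; split.
  - exact: measurable_cst.
  - by [].
  - rewrite (_ : mkset _ = setT) ?probability_setT ?lee_fin; first by lra.
    by apply/seteqP; split=> // w _; exact: Acor.
rewrite /det_cost /rand_cost; congr ereal_sup; apply: eq_imagel => f _.
by rewrite -(expectation_cst (dirac tt)).
Qed.

Lemma det_upper_bound (R : realType) (d' k n : nat) : (1 <= d')%N -> (1 <= k)%N ->
  (0 < n)%N ->
  (det_query_complexity R (@brouwer_inputs d'.+1 n) (@fixed_points d'.+1 n) k <=
   ((k * (6 * d'.+1 * 2 ^ d'))%:R * n%:R `^ rate R d'.+1 k)%:E)%E.
Proof.
move=> hd hk n0; set X := n%:R `^ _.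
have X0 : 0 <= X by exact: powR_ge0.
have [ls [sz lst pls]] := scales R d'.+1 k hd hk n n0.
pose q := Num.truncn ((6 * d'.+1 * 2 ^ d')%:R * X).
have [||A Acor Aq] := @brouwer_algorithm d' n q ls n0 _ _ lst.
- apply: sub_path pls => l s /and4P[s0 sl lX _]; rewrite s0/= truncn_ge_nat; last first.
    by rewrite mulr_ge0.
  have s0R : 0 < s%:R :> R by rewrite ltr0n.
  rewrite -(ler_pM2r s0R) -natrM.
  (* The 3 comes from [l %/ s + 2] with [s <= l], the power of 2 from [l.+1 <= 2 * l]; [scales]
     gives a further 2, hence 6. *)
  apply: (@le_trans _ _ ((3 * d'.+1 * 2 ^ d' * l ^ d'.+1)%N%:R)).
    rewrite ler_nat.
    have h1 : ((l %/ s).+2 * s <= 3 * l)%N by have := leq_divM l s; lia.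
    have h2 : (l.+1 ^ d' <= 2 ^ d' * l ^ d')%N by rewrite -expnMn leq_exp2r//; lia.
    have := leq_mul h1 h2; rewrite expnS; move: (l.+1 ^ d')%N (2 ^ d')%N (l ^ d')%N.
    by move=> a b c; nia.
  rewrite natrM (_ : (6 * _ * _)%N = 2 * (3 * d'.+1 * 2 ^ d'))%N; last by lia.
  rewrite [in X in _ <= X]natrM -!mulrA [X in _ <= X]mulrCA ler_wpM2l//.
  by rewrite mulrA.
- by rewrite -size_eq0 sz -lt0n.
move: A Acor Aq; rewrite sz => A Acor Aq.
apply: (@le_trans _ _ (det_cost R (@brouwer_inputs d'.+1 n) A)).
  by apply: ereal_inf_lbound; exists A.
apply/ereal_supP => _ [f /Aq fq <-]; rewrite lee_fin.
apply: (@le_trans _ _ ((k * q)%N%:R)); first by rewrite ler_nat.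
rewrite natrM natrM -mulrA ler_wpM2l//.
by rewrite truncn_le mulr_ge0.
Qed.

(** If the cost were below [X / (144 * D * k)], then with [q] about [12 * C] exceeding [q] queries
    has probability at most 1/12 and hits gain less than 1/12. But [2/3 - 1/12 = 1/2 + 1/12]. *)
Lemma rand_lower_bound (R : realType) (d' k : nat) : (1 <= d')%N -> (1 <= k)%N ->
  exists2 c : R, 0 < c & forall n : nat, (4 * k <= n)%N ->
  ((c * n%:R `^ rate R d'.+1 k)%:E <=
   rand_query_complexity R (@brouwer_inputs d'.+1 n) (@fixed_points d'.+1 n) k)%E.
Proof.
move=> hd hk; set rho := rate R d'.+1 k.
have rho0 : 0 <= rho by exact: rate_ge0.
(* Combines [2 * s + 1 <= 3 * s], the power from [card_near_axis] with [M = k + 1], and the [2 ^ d]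
   from [scales]. *)
pose D : R := (3 * (4 * k.+1).+1 ^ d'.+1 * 2 ^ d'.+1)%N%:R.
have D1 : 1 <= D by rewrite ler1n !muln_gt0 !expn_gt0.
have k0 : 0 < k%:R :> R by rewrite ltr0n.
pose c0 : R := (8 * k)%N%:R `^ (- rho).
have c00 : 0 < c0 by rewrite powR_gt0// ltr0n; lia.
have D0 : 0 < D by exact: lt_le_trans D1.
exists (c0 / (144 * D * k%:R)); first by rewrite divr_gt0// !mulr_gt0.
(* The tube has extent at most [2 * k * m + 1], so it fits into the grid. As [m] is positive,
   [n <= 8 * k * m], which yields [c0]. *)
move=> n nk; pose m := (n %/ (4 * k))%N.
have m0 : (0 < m)%N by rewrite divn_gt0//; lia.
pose X := m%:R `^ rho : R.
have X0 : 0 < X by rewrite powR_gt0// ltr0n.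
have XE : c0 * n%:R `^ rho <= X.
  have nm : n%:R <= (8 * k)%N%:R * m%:R :> R.
    have := ltn_ceil n (_ : 0 < 4 * k)%N; rewrite -/m -natrM ler_nat => H.
    have {}H : (n < m.+1 * (4 * k))%N by apply: H; lia.
    by nia.
  rewrite /c0 powRN ler_pdivrMl ?powR_gt0 ?ltr0n//; last by lia.
  by rewrite -powRM// ge0_ler_powR// ?nnegrE// mulr_ge0.
have [ls [sz lst pls]] := scales R d'.+1 k hd hk m m0.
rewrite -/rho -/X in pls.
pose eps := D / X.
have eps0 : 0 <= eps by rewrite divr_ge0// ltW.
have mn : (2 * sumn (belast m ls) + 1 < n)%N.
  have := @sumn_belast m ls; rewrite sz => /(_ _)H.
  have {}H : (sumn (belast m ls) <= k * m)%N.
    by apply: H; apply: sub_path pls => l s /and4P[].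
  have := leq_divM n (4 * k); rewrite -/m; nia.
have epath : path (fun l s => (0 < s)%N &&
    (((2 * s).+1 * (4 * (size ls).+1).+1 ^ d'.+1)%:R <= eps * (l ^ d'.+1)%:R)) m ls.
  apply: sub_path pls => l s /and4P[s0 _ _ Xs]; rewrite s0/= sz /eps.
  rewrite mulrAC ler_pdivlMr//.
  apply: (@le_trans _ _ ((3 * (4 * k.+1).+1 ^ d'.+1)%N%:R * (X * s%:R))).
    rewrite mulrCA [leLHS]mulrC ler_wpM2l ?(ltW X0)// -natrM ler_nat mulnAC.
    by rewrite leq_mul2r; apply/orP; right; lia.
  apply: (le_trans (ler_wpM2l _ Xs)) => //.
  by rewrite /D -!natrM ler_nat mulnA.
apply/ereal_infP => _ [disp [T [P [A [Acor ->]]]]].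
move: A Acor; rewrite -{1 2 4}sz => A Acor.
rewrite leNgt; apply/negP => cost_lt.
(* The extended real cost gets a nonnegative real bound, 0 in the formal case [-oo]. *)
have [C C0 [costC CX]] : exists2 C : R, 0 <= C &
    (rand_cost (@brouwer_inputs d'.+1 n) P A <= C%:E)%E /\ C < X / (144 * D * k%:R).
  have lt0 : (rand_cost (@brouwer_inputs d'.+1 n) P A < (X / (144 * D * k%:R))%:E)%E.
    apply: lt_le_trans cost_lt _; rewrite lee_fin mulrAC.
    by rewrite ler_wpM2r// invr_ge0 !mulr_ge0// ltW.
  have Xpos : 0 < X / (144 * D * k%:R) by rewrite divr_gt0// !mulr_gt0.
  case: (rand_cost _ _ _) lt0 => [r| |]//.
    rewrite lte_fin => rX; exists (Num.max r 0); first by rewrite le_max lexx orbT.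
    by rewrite lee_fin le_max lexx gt_max rX.
  by move=> _; exists 0 => //; rewrite leNye.
pose q := Num.truncn (12 * C).
have C12 : 0 <= 12 * C by rewrite mulr_ge0.
have /andP[q1 q2] := truncn_itv C12; rewrite -/q in q1 q2.
have := rand_cost_bound _ _ n m q ls eps C _ _ P A eps0 m0 mn epath Acor costC.
have Cq : C / q.+1%:R <= 1 / 12 by rewrite ler_pdivrMr ?ltr0n//; lra.
have epsq : eps * (size ls)%:R * q%:R < 1 / 12.
  rewrite sz; apply: (@le_lt_trans _ _ (eps * k%:R * (12 * C))).
    by rewrite ler_wpM2l// mulr_ge0.
  move: CX; rewrite ltr_pdivlMr ?mulr_gt0// => CX.
  rewrite /eps -mulrA mulrAC ltr_pdivrMr//.
  by rewrite (_ : D * _ = (C * (144 * D * k%:R)) / 12); [lra|field].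
by move: (C / _) (eps * _ * _) Cq epsq => y z; lra.
Qed.

Theorem theorem5 (R : realType) (d k : nat) (hd : (2 <= d)%N) (hk : (1 <= k)%N) :
  let growth := fun n : nat =>
    n%:R `^ ((d%:R ^+ k.+1 - d%:R ^+ k) / (d%:R ^+ k - 1)) : R in
  brouwer_det R d k =Theta_\oo growth /\ brouwer_rand R d k =Theta_\oo growth.
Proof.
case: d hd => [//|d'] hd growth.
have [c c0 lower] := @rand_lower_bound R d' k hd hk.
pose c' : R := (k * (6 * d'.+1 * 2 ^ d'))%:R.
have c'0 : 0 < c' by rewrite ltr0n !muln_gt0 expn_gt0 hk.
have bounds n : (4 * k <= n)%N ->
    (c * growth n <= brouwer_rand R d'.+1 k n) /\
    (brouwer_rand R d'.+1 k n <= brouwer_det R d'.+1 k n) /\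
    (brouwer_det R d'.+1 k n <= c' * growth n).
  move=> nk; have n0 : (0 < n)%N by lia.
  have := lower n nk.
  have := rand_le_det R _ _ _ (@brouwer_inputs d'.+1 n) (@fixed_points d'.+1 n) k.
  have := det_upper_bound R d' k n hd hk n0.
  rewrite /brouwer_rand /brouwer_det -/(growth n) -/c'.
  (* The two bounds exclude infinite values, so [fine] returns the complexity itself. *)
  case: det_query_complexity => [x| |]//; case: rand_query_complexity => [y| |]//=.
have growth0 n : 0 <= growth n by exact: powR_ge0.
split; rewrite eqThetaE qualifE; apply/asboolP; exists (c, c');
  rewrite ?c0 ?c'0//; exists (4 * k)%N => // n /= /bounds[lo [mid up]];
  have cg : 0 <= c * growth n by rewrite mulr_ge0// ltW.
- by rewrite !ger0_norm//; [split=> //; exact: le_trans lo mid|lra].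
- by rewrite !ger0_norm//; [split=> //; exact: le_trans mid up|lra].
Qed.
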